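(* Let the standing assumptions (see context) hold for $T,m,n,r,F,B,L_F,\varepsilon_r$, let $t_0\in[0,T]$, and let $A(t)$ solve $\dot A(t)=F(t,A(t))$, $A(t_0)=A_0$, on $[t_0,T]$. Suppose that $Y_0=U_0S_0V_0^\top\in\mathbb{R}^{m\times n}$ has rank $r$, with $U_0\in\mathbb{R}^{m\times r}$, $V_0\in\mathbb{R}^{n\times r}$ having orthonormal columns and $S_0\in\mathbb{R}^{r\times r}$ invertible, and satisfies $\|Y_0-A(t_0)\|\le\delta$. There exist $h_0>0$ and $C_T>0$, depending only on $m,n,r,B,L_F$ and $T$, such that every rank-admissible sequence $(Y_n)$ generated from $(U_0,S_0,V_0)$ by prescribed increments $\Delta A_n$ with stepsize $0<h\le h_0$ satisfies $$\max_{t_n\le T}\|Y_n-A(t_n)\|\le C_T\left(\delta+\varepsilon_r+\frac{d_h}{h}\right).$$ In particular, if $p\ge1$ and $C_{\rm inc}$ is a constant independent of $h$, then $$d_h\le C_{\rm inc}(h^{p+1}+h\varepsilon_r)\quad\Longrightarrow\quad\max_{t_n\le T}\|Y_n-A(t_n)\|\le C_T'(\delta+\varepsilon_r+h^p),$$ where $C_T'$ depends only on $m,n,r,B,L_F,T$ and $C_{\rm inc}$. The constants are independent of the singular values along the numerical trajectory.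
   Context: $\|\cdot\|$ is the Frobenius norm. Standing assumptions: $T>0$; $m,n,r$ are integers with $1\le r<\min(m,n)$; $F:[0,T]\times\mathbb{R}^{m\times n}\to\mathbb{R}^{m\times n}$ is continuous, and there are constants $B,L_F$ such that for all $t\in[0,T]$ and $X,Z\in\mathbb{R}^{m\times n}$, $$\|F(t,X)\|\le B,\qquad\|F(t,X)-F(t,Z)\|\le L_F\|X-Z\|;$$ and for some $\varepsilon_r\ge0$, for all $t\in[0,T]$ and every rank-$r$ matrix $Y=USV^\top$ ($U\in\mathbb{R}^{m\times r}$, $V\in\mathbb{R}^{n\times r}$ with orthonormal columns, $S\in\mathbb{R}^{r\times r}$ invertible), $$\|(I-UU^\top)F(t,Y)(I-VV^\top)\|\le\varepsilon_r.$$ Reduced $K$-$L$ step, started from $(U_n,S_n,V_n)$ with increment $\Delta A_n\in\mathbb{R}^{m\times n}$ (where $Y_n=U_nS_nV_n^\top$, $U_n^\top U_n=V_n^\top V_n=I_r$, $S_n$ invertible): (1) set $K:=U_nS_n+\Delta A_n\,V_n=(Y_n+\Delta A_n)V_n$ and compute a factorization $U_{n+1}\widehat S_{n+1}=K$, where $U_{n+1}\in\mathbb{R}^{m\times r}$ has orthonormal columns; (2) set $L:=V_nS_n^\top U_n^\top U_{n+1}+\Delta A_n^\top U_{n+1}=(Y_n+\Delta A_n)^\top U_{n+1}$ and compute a factorization $V_{n+1}S_{n+1}^\top=L$, where $V_{n+1}\in\mathbb{R}^{n\times r}$ has orthonormal columns. The output is $Y_{n+1}:=U_{n+1}S_{n+1}V_{n+1}^\top$.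 The step is rank-admissible when $\operatorname{rank}K=r$ (then also $\operatorname{rank}L=r$, so $S_{n+1}$ is invertible and the next step can be started). Sequence generated by prescribed increments: with $t_n:=t_0+nh$, at every step $n\ge0$ with $t_{n+1}\le T$ a matrix $\Delta A_n\in\mathbb{R}^{m\times n}$ is prescribed (it may depend on previously computed quantities), and the reduced $K$-$L$ step is applied to $(U_n,S_n,V_n)$ with increment $\Delta A_n$ to give $Y_{n+1}=U_{n+1}S_{n+1}V_{n+1}^\top$. The sequence is rank-admissible if every one of these steps is rank-admissible. Increment error: $A_n(s)$ is the solution of $\dot A_n(s)=F(t_n+s,A_n(s))$, $A_n(0)=Y_n$, and $$d_n:=\|Y_n+\Delta A_n-A_n(h)\|,\qquad d_h:=\max_{t_{n+1}\le T}d_n.$$ *)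

(* Defs.v *)
From HB Require Import structures.
From mathcomp Require Import all_boot all_order all_algebra.
From mathcomp Require Import all_classical all_reals all_analysis.

Set Implicit Arguments.
Unset Strict Implicit.
Unset Printing Implicit Defensive.

Import Order.TTheory GRing.Theory Num.Theory.
Import numFieldNormedType.Exports.

Local Open Scope classical_set_scope.
Local Open Scope ring_scope.

(* The library norm `|X| on matrices is the max norm, so the Frobenius norm is
   defined here. Both induce the library topology on 'M[R]_(m, n). *)
Definition frob (R : realType) (m n : nat) (X : 'M[R]_(m, n)) : R :=
  Num.sqrt (\sum_(i < m) \sum_(j < n) X i j ^+ 2).

Definition orthonormal_cols (R : realType) (m r : nat) (U : 'M[R]_(m, r)) :
  Prop := U^T *m U = 1%:M.

Record standing_assumptions (R : realType) (m n r : nat) (T B LF eps : R)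
    (F : R -> 'M[R]_(m, n) -> 'M[R]_(m, n)) : Prop := StandingAssumptions {
  F_continuous :
    {within [set p : R * 'M[R]_(m, n) | 0 <= p.1 <= T],
      continuous (fun p => F p.1 p.2)} ;
  F_bounded : forall (t : R) X, 0 <= t <= T -> frob (F t X) <= B ;
  F_lipschitz : forall (t : R) X Z, 0 <= t <= T ->
    frob (F t X - F t Z) <= LF * frob (X - Z) ;
  eps_ge0 : 0 <= eps ;
  F_normal_part : forall (t : R) (U : 'M[R]_(m, r)) (S : 'M[R]_r)
      (V : 'M[R]_(n, r)),
    0 <= t <= T -> orthonormal_cols U -> orthonormal_cols V -> S \in unitmx ->
    frob ((1%:M - U *m U^T) *m F t (U *m S *m V^T) *m (1%:M - V *m V^T)) <= eps
}.

(* Derivative relative to [a, b]: one-sided at the end points, no condition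
   when a = b. *)
Definition has_derivative_on (R : realType) (m n : nat) (a b : R)
    (A : R -> 'M[R]_(m, n)) (t : R) (D : 'M[R]_(m, n)) : Prop :=
  (fun s => (s - t)^-1 *: (A s - A t)) @ within `[a, b] t^' --> D.

Definition solves_ivp (R : realType) (m n : nat)
    (F : R -> 'M[R]_(m, n) -> 'M[R]_(m, n)) (a b : R) (X0 : 'M[R]_(m, n))
    (A : R -> 'M[R]_(m, n)) : Prop :=
  A a = X0 /\
  forall t, a <= t <= b -> has_derivative_on a b A t (F t (A t)).

Section ReducedKL.
Context {R : realType} {m n r : nat}.
Implicit Types (U : 'M[R]_(m, r)) (S : 'M[R]_r) (V : 'M[R]_(n, r)).
Implicit Types (dA : 'M[R]_(m, n)).

Definition K_matrix U S V dA : 'M[R]_(m, r) := U *m S + dA *m V.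

Definition L_matrix U S V dA U' : 'M[R]_(n, r) :=
  V *m S^T *m U^T *m U' + dA^T *m U'.

(* A relation and not a function: the orthonormal factorizations of K and L
   are not unique. *)
Definition reduced_KL_step U S V dA U' S' V' : Prop :=
  [/\ orthonormal_cols U',
      exists S_hat : 'M[R]_r, U' *m S_hat = K_matrix U S V dA,
      orthonormal_cols V' &
      V' *m S'^T = L_matrix U S V dA U'].

Definition rank_admissible_step U S V dA : Prop :=
  \rank (K_matrix U S V dA) = r.

End ReducedKL.

Definition grid (R : realType) (t0 h : R) (k : nat) : R := t0 + k%:R * h.

(* For 0 < h, the steps k with t_(k+1) <= T are those with k < nsteps. *)
Definition nsteps (R : realType) (T t0 h : R) : nat :=
  Num.truncn ((T - t0) / h).

Lemma ltn_nsteps (R : realType) (T t0 h : R) (k : nat) :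
  t0 <= T -> 0 < h -> (k < nsteps T t0 h)%N = (grid t0 h k.+1 <= T).
Proof.
move=> t0T h0.
rewrite /nsteps /grid truncn_ge_nat ?divr_ge0 ?subr_ge0 ?(ltW h0)//.
by rewrite ler_pdivlMr// lerBrDl.
Qed.

Definition lowrank_iterate (R : realType) (m n r : nat) (U : nat -> 'M[R]_(m, r))
    (S : nat -> 'M[R]_r) (V : nat -> 'M[R]_(n, r)) (k : nat) : 'M[R]_(m, n) :=
  U k *m S k *m (V k)^T.

Definition rank_admissible_sequence (R : realType) (m n r : nat) (T t0 h : R)
    (U0 : 'M[R]_(m, r)) (S0 : 'M[R]_r) (V0 : 'M[R]_(n, r))
    (dA : nat -> 'M[R]_(m, n)) (U : nat -> 'M[R]_(m, r))
    (S : nat -> 'M[R]_r) (V : nat -> 'M[R]_(n, r)) : Prop :=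
  [/\ U 0%N = U0, S 0%N = S0, V 0%N = V0 &
      forall k, grid t0 h k.+1 <= T ->
        rank_admissible_step (U k) (S k) (V k) (dA k) /\
        reduced_KL_step (U k) (S k) (V k) (dA k) (U k.+1) (S k.+1) (V k.+1)].

Definition local_solutions (R : realType) (m n : nat) (T t0 h : R)
    (F : R -> 'M[R]_(m, n) -> 'M[R]_(m, n)) (Y : nat -> 'M[R]_(m, n))
    (Aloc : nat -> R -> 'M[R]_(m, n)) : Prop :=
  forall k, grid t0 h k.+1 <= T ->
    solves_ivp (fun s X => F (grid t0 h k + s) X) 0 h (Y k) (Aloc k).

(* d_h, with the convention that it is 0 when there is no step. *)
Definition max_increment_error (R : realType) (m n : nat) (T t0 h : R)
    (Y dA : nat -> 'M[R]_(m, n)) (Aloc : nat -> R -> 'M[R]_(m, n)) : R :=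
  \big[Num.max/0]_(k < nsteps T t0 h) frob (Y k + dA k - Aloc k h).

Definition max_global_error (R : realType) (m n : nat) (T t0 h : R)
    (Y : nat -> 'M[R]_(m, n)) (A : R -> 'M[R]_(m, n)) : R :=
  \big[Num.max/0]_(k < (nsteps T t0 h).+1) frob (Y k - A (grid t0 h k)).

(* Main.v *)
Require Import Defs.
From HB Require Import structures.
From mathcomp Require Import all_boot all_order all_algebra.
From mathcomp Require Import all_classical all_reals all_analysis.
From mathcomp Require Import ring lra.

Set Implicit Arguments.
Unset Strict Implicit.
Unset Printing Implicit Defensive.

Import Order.TTheory GRing.Theory Num.Theory.
Import numFieldNormedType.Exports.

Local Open Scope ring_scope.

(** The stated bound has no term in h beyond d_h / h, so an O(h^2) defect per
    step is too much: with A_n the exact solution started at Y_n, one step has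
    to satisfy
      |Y_(n+1) - A_n(h)| <= C (h eps + d_n),
    with C independent of the singular values of Y_n. Stability of the
    differential equation then adds up these local errors.

    The normal part of F is bounded by eps at every matrix of rank r, small
    singular values included, and r < min(m, n). Comparing Y with its
    compression to the orthogonal complements of x and y turns this into
      |x F(Y) y| <= eps |x| |y| + 2 L (|x Y| |y| + |x| |Y y|)
    for all x, y and all Y of rank at most r ([tangency_estimate]). Gaussian
    elimination with complete pivoting brings Y to diagonal form by bounded
    changes of basis, and entry by entry the estimate gives
      F(Y) = M Y + Y N + E,   |M|, |N| <= c L,   |E| <= c eps
    ([tangent_splitting]). In the flow of such a field, singular values change
    by relative amounts: A_n(h) = Phi Y_n Psi + O(h eps) with Psi = I + O(h)
    ([low_rank_tracking]).

    The step returns P (Y_n + dA_n), where P projects orthogonally onto a space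
    that contains the columns of (Y_n + dA_n) V_n. Up to O(h eps + d_n), the
    matrix Y_n + dA_n is H V_n^T Psi for some H, and V_n^T Psi V_n is close to I
    for small h. Hence I - P, which annihilates (Y_n + dA_n) V_n, makes H, and
    so all of Y_n + dA_n, as small as the remainder ([projection_defect]).
    This bound does not involve the conditioning of H or of Y_n.

    The splitting provides M and N separately at each time, without any
    regularity in time, so they cannot be integrated. Statements about
    trajectories are therefore propagated by real induction over short
    increments, with F evaluated at a single point of each increment
    ([straddle_induction]). *)

(** * Frobenius norm *)

Lemma le_of_slack (R : realFieldType) (a b K : R) :
  0 <= K -> (forall e, 0 < e -> a <= b + K * e) -> a <= b.
Proof.
move=> K0 ab; apply/ler_addgt0Pr => e e0.
have K1 : 0 < K + 1 by lra.
apply: le_trans (ab (e / (K + 1)) _) _; first by rewrite divr_gt0.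
by rewrite lerD2l mulrCA ger_pMr// ler_pdivrMr// mul1r lerDl.
Qed.

Lemma CauchySchwarz_sum (R : realFieldType) (I : finType) (a b : I -> R) :
  (\sum_i a i * b i) ^+ 2 <= (\sum_i a i ^+ 2) * (\sum_i b i ^+ 2).
Proof.
set A := \sum_i a i ^+ 2; set B := \sum_i b i ^+ 2; set C := \sum_i a i * b i.
have A0 : 0 <= A by apply: sumr_ge0 => i _; exact: sqr_ge0.
have quad (x : R) : 0 <= x ^+ 2 * A - (2 * x) * C + B.
  have -> : x ^+ 2 * A - (2 * x) * C + B = \sum_i (x * a i - b i) ^+ 2.
    rewrite /A /B /C !mulr_sumr -sumrB -big_split /=.
    by apply: eq_bigr => i _; ring.
  by apply: sumr_ge0 => i _; exact: sqr_ge0.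
have [A_eq0|A_neq0] := eqVneq A 0.
  have a0 i : a i = 0.
    apply/eqP; rewrite -sqrf_eq0; apply/eqP.
    move/eqP: A_eq0; rewrite psumr_eq0; last by move=> j _; exact: sqr_ge0.
    by move/allP => /(_ i); rewrite mem_index_enum => /(_ isT) /eqP.
  by rewrite A_eq0 mul0r /C big1 ?expr0n// => i _; rewrite a0 mul0r.
have A_gt0 : 0 < A by rewrite lt_def A_neq0.
have := quad (C / A).
have -> : (C / A) ^+ 2 * A - 2 * (C / A) * C + B = (A * B - C ^+ 2) / A by field.
by rewrite pmulr_lge0 ?invr_gt0// subr_ge0.
Qed.

Section Frobenius.
Context {R : realType}.
Implicit Types m n p : nat.

Lemma frob_ge0 m n (X : 'M[R]_(m, n)) : 0 <= frob X.
Proof. exact: sqrtr_ge0. Qed.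

Lemma frob_sqr m n (X : 'M[R]_(m, n)) :
  frob X ^+ 2 = \sum_(p : 'I_m * 'I_n) X p.1 p.2 ^+ 2.
Proof.
rewrite sqr_sqrtr; last by do 2!apply: sumr_ge0 => ? _; exact: sqr_ge0.
by rewrite pair_big.
Qed.

Lemma le_frob m n (X : 'M[R]_(m, n)) (a : R) :
  0 <= a -> \sum_(p : 'I_m * 'I_n) X p.1 p.2 ^+ 2 <= a ^+ 2 -> frob X <= a.
Proof. by move=> a0; rewrite -frob_sqr ler_pXn2r ?nnegrE ?frob_ge0. Qed.

Lemma frob0 m n : frob (0 : 'M[R]_(m, n)) = 0.
Proof.
by rewrite /frob big1 ?sqrtr0// => i _; rewrite big1// => j _; rewrite mxE expr0n.
Qed.

Lemma frobZ m n (a : R) (X : 'M[R]_(m, n)) : frob (a *: X) = `|a| * frob X.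
Proof.
rewrite -[`|a|]sqrtr_sqr /frob -sqrtrM ?sqr_ge0//; congr Num.sqrt.
rewrite mulr_sumr; apply: eq_bigr => i _; rewrite mulr_sumr.
by apply: eq_bigr => j _; rewrite mxE exprMn.
Qed.

Lemma frobN m n (X : 'M[R]_(m, n)) : frob (- X) = frob X.
Proof. by rewrite -scaleN1r frobZ normrN normr1 mul1r. Qed.

Lemma frob_distC m n (X Y : 'M[R]_(m, n)) : frob (X - Y) = frob (Y - X).
Proof. by rewrite -frobN opprB. Qed.

Lemma frob_tr m n (X : 'M[R]_(m, n)) : frob X^T = frob X.
Proof.
rewrite /frob exchange_big /=; congr Num.sqrt.
by apply: eq_bigr => i _; apply: eq_bigr => j _; rewrite mxE.
Qed.

Lemma frobD m n (X Y : 'M[R]_(m, n)) : frob (X + Y) <= frob X + frob Y.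
Proof.
apply: le_frob; first by rewrite addr_ge0 ?frob_ge0.
have -> : \sum_p (X + Y) p.1 p.2 ^+ 2 =
    frob X ^+ 2 + 2 * (\sum_p X p.1 p.2 * Y p.1 p.2) + frob Y ^+ 2.
  rewrite !frob_sqr mulr_sumr -!big_split /=.
  by apply: eq_bigr => i _; rewrite mxE; ring.
have : \sum_p X p.1 p.2 * Y p.1 p.2 <= frob X * frob Y.
  apply: le_trans (ler_norm _) _.
  rewrite -(ler_pXn2r (n := 2))// ?nnegrE ?mulr_ge0 ?frob_ge0//.
  rewrite real_normK ?num_real// exprMn !frob_sqr.
  exact: (CauchySchwarz_sum (fun q : 'I_m * 'I_n => X q.1 q.2) (fun q => Y q.1 q.2)).
by lra.
Qed.

Lemma frobB m n (X Y : 'M[R]_(m, n)) : frob (X - Y) <= frob X + frob Y.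
Proof. by rewrite -(frobN Y) frobD. Qed.

Lemma frob_sub m n (X Y Z : 'M[R]_(m, n)) :
  frob (X - Z) <= frob (X - Y) + frob (Y - Z).
Proof. by rewrite -[X - Z](subrKA Y) frobD. Qed.

Lemma frobM m n p (X : 'M[R]_(m, n)) (Y : 'M[R]_(n, p)) :
  frob (X *m Y) <= frob X * frob Y.
Proof.
apply: le_frob; first by rewrite mulr_ge0 ?frob_ge0.
rewrite exprMn.
have -> : frob X ^+ 2 * frob Y ^+ 2 =
    \sum_(q : 'I_m * 'I_p) (\sum_k X q.1 k ^+ 2) * (\sum_k Y k q.2 ^+ 2).
  rewrite [frob Y]/frob exchange_big /= /frob !sqr_sqrtr; first last.
  - by do 2!apply: sumr_ge0 => ? _; exact: sqr_ge0.
  - by do 2!apply: sumr_ge0 => ? _; exact: sqr_ge0.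
  rewrite mulr_suml.
  rewrite -(pair_big xpredT xpredT
    (fun i j => (\sum_k X i k ^+ 2) * (\sum_k Y k j ^+ 2)))/=.
  by apply: eq_bigr => i _; rewrite mulr_sumr.
by apply: ler_sum => q _; rewrite mxE CauchySchwarz_sum.
Qed.

Lemma frob_sandwich m n p q (X : 'M[R]_(m, n))
    (G : 'M[R]_(n, p)) (Y : 'M[R]_(p, q)) :
  frob (X *m G *m Y) <= frob X * frob Y * frob G.
Proof.
apply: le_trans (frobM _ _) _; rewrite mulrAC.
by apply: ler_wpM2r; rewrite ?frob_ge0 ?frobM.
Qed.

Lemma entry_le_frob m n (X : 'M[R]_(m, n)) i j : `|X i j| <= frob X.
Proof.
rewrite -(ler_pXn2r (n := 2))// ?nnegrE ?frob_ge0// real_normK ?num_real//.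
rewrite frob_sqr (bigD1 (i, j))//= lerDl.
by apply: sumr_ge0 => ? _; exact: sqr_ge0.
Qed.

Lemma frob_le_entries m n (X : 'M[R]_(m, n)) (e : R) :
  0 <= e -> (forall i j, `|X i j| <= e) -> frob X <= (m * n)%:R * e.
Proof.
move=> e0 Xe; apply: le_frob; first by rewrite mulr_ge0.
apply: (@le_trans _ _ (\sum_(p : 'I_m * 'I_n) e ^+ 2)).
  apply: ler_sum => p _; rewrite -real_normK ?num_real//.
  by rewrite ler_pXn2r ?nnegrE.
rewrite sumr_const card_prod !card_ord exprMn -[leLHS]mulr_natl.
apply: ler_wpM2r; first exact: sqr_ge0.
by rewrite -natrX ler_nat; case: (m * n)%N => // k; rewrite -[leqLHS]muln1 leq_mul.
Qed.

Lemma frob_unique0 m n (X : 'M[R]_(m, n)) : frob X = 0 -> X = 0.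
Proof.
move=> X0; apply/matrixP => i j; rewrite mxE; apply/eqP.
by rewrite -normr_le0 -X0 entry_le_frob.
Qed.

Lemma frob_gt0 m n (X : 'M[R]_(m, n)) : X != 0 -> 0 < frob X.
Proof.
by rewrite lt_def frob_ge0 andbT; apply: contra => /eqP /frob_unique0 ->.
Qed.

Lemma frob1_le n : frob (1%:M : 'M[R]_n) <= (n * n)%:R.
Proof.
rewrite -[leRHS]mulr1; apply: frob_le_entries => // i j.
by rewrite mxE; case: eqP; rewrite ?normr0 ?normr1.
Qed.

Lemma orthonormal_cols_frob m r (U : 'M[R]_(m, r)) :
  orthonormal_cols U -> frob U <= r%:R.
Proof.
move=> UU; apply: le_frob => //.
have -> : \sum_p U p.1 p.2 ^+ 2 = \tr (U^T *m U).
  rewrite -(pair_big xpredT xpredT (fun i j => U i j ^+ 2))/= exchange_big /=.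
  by apply: eq_bigr => j _; rewrite mxE; apply: eq_bigr => i _; rewrite mxE -expr2.
rewrite UU mxtrace1 -natrX ler_nat.
by case: r {U UU} => // k; rewrite -[leqLHS]muln1 leq_mul.
Qed.

End Frobenius.

(** * Tangency of the field at matrices of rank at most r *)

Section OrthonormalBases.
Context {R : realType}.
Implicit Types k m n r : nat.

Lemma tr_mul_col m (u : 'cV[R]_m) : u^T *m u = (frob u ^+ 2)%:M.
Proof.
rewrite [LHS]mx11_scalar; congr (_%:M); rewrite sqr_sqrtr; last first.
  by do 2!apply: sumr_ge0 => ? _; exact: sqr_ge0.
by rewrite mxE; apply: eq_bigr => i _; rewrite big_ord1 mxE expr2.
Qed.

Lemma normalized_col m (u : 'cV[R]_m) :
  u != 0 -> orthonormal_cols ((frob u)^-1 *: u).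
Proof.
move=> /frob_gt0 u0; rewrite /orthonormal_cols tr_mul_col frobZ.
by rewrite ger0_norm ?invr_ge0 ?frob_ge0// mulVf ?gt_eqF// expr1n.
Qed.

Lemma unit_vector_in_kernel k m (X : 'M[R]_(k, m)) :
  (k < m)%N -> exists u : 'cV[R]_m, X *m u = 0 /\ orthonormal_cols u.
Proof.
move=> km; pose v := nz_row (kermx X^T).
have v0 : v^T != 0.
  rewrite -[0]trmx0 (inj_eq trmx_inj) nz_row_eq0 kermx_eq0.
  apply: contraL km => /eqP rX.
  by rewrite -leqNgt -rX rank_leq_col.
exists ((frob v^T)^-1 *: v^T); split; last exact: normalized_col.
rewrite -scalemxAr -[X]trmxK -trmx_mul.
have /sub_kermxP -> : (v <= kermx X^T)%MS by exact: nz_row_sub.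
by rewrite trmx0 scaler0.
Qed.

(** Gram-Schmidt with room to spare: the constraint X u = 0 is inherited by
    every new basis vector, and a zero column is replaced by any unit vector
    that satisfies the constraints, of which there are fewer than m. *)
Lemma orthonormal_basis_of_columns k m r (X : 'M[R]_(k, m)) (A : 'M[R]_(m, r)) :
  (k + r <= m)%N -> X *m A = 0 ->
  exists (U : 'M[R]_(m, r)) (C : 'M[R]_r),
    [/\ orthonormal_cols U, X *m U = 0 & A = U *m C].
Proof.
elim: r k X A => [|r IHr] k X A krm XA0.
  by exists A, 1%:M; split; rewrite ?mulmx1// /orthonormal_cols !flatmx0.
rewrite -[r.+1]add1n in A XA0 *.
set a := lsubmx A; set A' := rsubmx A.
have AE : A = row_mx a A' by rewrite hsubmxK.
have [Xa0 XA'0] : X *m a = 0 /\ X *m A' = 0.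
  by move: XA0; rewrite AE mul_mx_row -row_mx0 => /eq_row_mx.
have [u [Xu0 uu au]] : exists u : 'cV[R]_m,
    [/\ X *m u = 0, orthonormal_cols u & a = u *m (u^T *m a)].
  have [a0|a0] := eqVneq a 0.
    have [|u [Xu uu]] := @unit_vector_in_kernel k m X.
      by apply: leq_trans krm; rewrite -addSnnS leq_addr.
    by exists u; split; rewrite // a0 !mulmx0.
  exists ((frob a)^-1 *: a); split; last 1 first.
  - have fa0 : frob a != 0 by rewrite gt_eqF// frob_gt0.
    rewrite [(_ *: a)^T]linearZ /= -!scalemxAl tr_mul_col -scalemxAr.
    rewrite mul_mx_scalar !scalerA -[LHS]scale1r; congr (_ *: _); by field.
  - by rewrite -scalemxAr Xa0 scaler0.
  - exact: normalized_col.
pose A2 := A' - u *m (u^T *m A').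
have X'A2 : col_mx X u^T *m A2 = 0.
  rewrite mul_col_mx /A2 !mulmxBr XA'0 !mulmxA Xu0 uu mul1mx.
  by rewrite !mul0mx !subrr col_mx0.
have krm' : (k + 1 + r <= m)%N by rewrite -addnA add1n.
have [U' [C' [UU' X'U' A2E]]] := IHr _ _ _ krm' X'A2.
have [XU'0 uU'0] : X *m U' = 0 /\ u^T *m U' = 0.
  by move: X'U'; rewrite mul_col_mx -col_mx0 => /eq_col_mx.
exists (row_mx u U'), (block_mx (u^T *m a) (u^T *m A') 0 C'); split.
- rewrite /orthonormal_cols tr_row_mx mul_col_row uu UU' uU'0.
  have -> : U'^T *m u = 0 by rewrite -[LHS]trmxK trmx_mul trmxK uU'0 trmx0.
  by rewrite -scalar_mx_block.
- by rewrite mul_mx_row Xu0 XU'0 row_mx0.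
- by rewrite mul_row_block mulmx0 addr0 -au -A2E /A2 addrC subrK -AE.
Qed.

(** In a factorization S = C I_k R through the partial identity of rank
    k = rank S, fill the missing diagonal entries with a small eta. *)
Lemma unitmx_dense r (S : 'M[R]_r) (e : R) :
  0 < e -> exists2 S' : 'M[R]_r, S' \in unitmx & frob (S - S') <= e.
Proof.
move=> e0; set P : 'M[R]_r := pid_mx (\rank S).
have PP : P *m P = P by rewrite pid_mx_id ?rank_leq_row.
set D := col_ebase S *m (1%:M - P) *m row_ebase S.
have D1 : 0 < frob D + 1 by rewrite ltr_pwDr ?frob_ge0.
set eta := e / (frob D + 1); have eta0 : 0 < eta by rewrite divr_gt0.
have PQ : P *m (1%:M - P) = 0 by rewrite mulmxBr mulmx1 PP subrr.
have QP : (1%:M - P) *m P = 0 by rewrite mulmxBl mul1mx PP subrr.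
have QQ : (1%:M - P) *m (1%:M - P) = 1%:M - P.
  by rewrite mulmxBl PQ subr0 mul1mx.
have /mulmx1_unit[Du _] : (P + eta *: (1%:M - P)) *m (P + eta^-1 *: (1%:M - P)) = 1%:M.
  rewrite mulmxDl !mulmxDr -!scalemxAl -!scalemxAr PP PQ QP QQ !scaler0 addr0.
  by rewrite add0r scalerA divff ?gt_eqF// scale1r addrC subrK.
exists (col_ebase S *m (P + eta *: (1%:M - P)) *m row_ebase S).
  by rewrite !unitmx_mul col_ebase_unit row_ebase_unit Du.
rewrite mulmxDr mulmxDl -/P mulmx_ebase -scalemxAr -scalemxAl -/D.
rewrite opprD addNKr frobN frobZ gtr0_norm// /eta mulrAC -mulrA.
by rewrite ger_pMr// ler_pdivrMr// mul1r lerDl.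
Qed.

End OrthonormalBases.

Section TangencyEstimate.
Context {R : realType} {m n r : nat} {L eps : R}.
Context (G : 'M[R]_(m, n) -> 'M[R]_(m, n)).
Context (rm : (r < m)%N) (rn : (r < n)%N) (L0 : 0 <= L) (eps0 : 0 <= eps).
Context (G_lipschitz : forall X Z, frob (G X - G Z) <= L * frob (X - Z)).
Context (G_normal_part :
  forall (U : 'M[R]_(m, r)) (S : 'M[R]_r) (V : 'M[R]_(n, r)),
    orthonormal_cols U -> orthonormal_cols V -> S \in unitmx ->
    frob ((1%:M - U *m U^T) *m G (U *m S *m V^T) *m (1%:M - V *m V^T)) <= eps).

(** Since r < min(m, n), orthonormal U and V of r columns can be chosen
    orthogonal to x and y even when A and B are rank deficient. The bound then
    holds for products A B of any rank up to r because the matrices U S V^T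
    with S invertible are dense among the U S V^T. *)
Lemma normal_component_le (A : 'M[R]_(m, r)) (B : 'M[R]_(r, n))
    (x : 'rV[R]_m) (y : 'cV[R]_n) :
  x *m A = 0 -> B *m y = 0 ->
  frob (x *m G (A *m B) *m y) <= eps * (frob x * frob y).
Proof.
move=> xA0 By0.
have [|U [C [UU xU AE]]] := orthonormal_basis_of_columns _ xA0.
  by rewrite add1n.
have yB0 : y^T *m B^T = 0 by rewrite -trmx_mul By0 trmx0.
have [|V [D [VV yV BE]]] := orthonormal_basis_of_columns _ yB0.
  by rewrite add1n.
have Vy : V^T *m y = 0 by rewrite -[LHS]trmxK trmx_mul trmxK yV trmx0.
have YE : A *m B = U *m (C *m D^T) *m V^T.
  by rewrite AE -[B]trmxK BE trmx_mul !mulmxA.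
apply: (@le_of_slack _ _ _ (frob x * frob y * (L * (frob U * frob V)))).
  by rewrite !mulr_ge0 ?frob_ge0.
move=> e e0; have [S' S'u S'e] := unitmx_dense (C *m D^T) e0.
set Y' := U *m S' *m V^T.
have -> : x *m G (A *m B) *m y =
    x *m (G (A *m B) - G Y') *m y +
    x *m ((1%:M - U *m U^T) *m G Y' *m (1%:M - V *m V^T)) *m y.
  have xP : x *m (1%:M - U *m U^T) = x.
    by rewrite mulmxBr mulmx1 mulmxA xU mul0mx subr0.
  have Qy : (1%:M - V *m V^T) *m y = y.
    by rewrite mulmxBl mul1mx -mulmxA Vy mulmx0 subr0.
  rewrite [x *m (_ *m G Y' *m _)]mulmxA [x *m (_ *m G Y')]mulmxA xP.
  by rewrite -[x *m G Y' *m _ *m y]mulmxA Qy mulmxBr mulmxBl subrK.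
rewrite addrC; apply: le_trans (frobD _ _) _; apply: lerD.
  apply: le_trans (frob_sandwich _ _ _) _; rewrite mulrC.
  by rewrite ler_wpM2r ?mulr_ge0 ?frob_ge0 ?G_normal_part.
apply: le_trans (frob_sandwich _ _ _) _; rewrite -[leRHS]mulrA.
apply: ler_wpM2l; first by rewrite mulr_ge0 ?frob_ge0.
apply: le_trans (G_lipschitz _ _) _; rewrite -[leRHS]mulrA; apply: ler_wpM2l => //.
rewrite YE -mulmxBl -mulmxBr; apply: le_trans (frobM _ _) _; rewrite frob_tr.
rewrite mulrAC; apply: ler_wpM2r; first exact: frob_ge0.
apply: le_trans (frobM _ _) _; apply: ler_wpM2l => //; exact: frob_ge0.
Qed.

(** With unit x and y, compare Y = A B with its compression
    Y' = (I - x x^T) Y (I - y y^T), for which the previous bound holds: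
    Y - Y' = x x^T Y + (I - x x^T) Y y y^T is controlled by x^T Y and Y y. *)
Lemma tangency_estimate (A : 'M[R]_(m, r)) (B : 'M[R]_(r, n))
    (x : 'rV[R]_m) (y : 'cV[R]_n) :
  frob (x *m G (A *m B) *m y) <= eps * (frob x * frob y) +
    2 * L * (frob (x *m (A *m B)) * frob y + frob x * frob (A *m B *m y)).
Proof.
have rhs0 : 0 <= eps * (frob x * frob y) +
    2 * L * (frob (x *m (A *m B)) * frob y + frob x * frob (A *m B *m y)).
  by rewrite !(addr_ge0, mulr_ge0, frob_ge0).
have [x0|x0] := eqVneq x 0; first by rewrite {1}x0 !mul0mx frob0.
have [y0|y0] := eqVneq y 0; first by rewrite {1}y0 !mulmx0 frob0.
set Y := A *m B in rhs0 *.
have fx := frob_gt0 x0; have fy := frob_gt0 y0.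
have xT0 : x^T != 0 by rewrite -[0]trmx0 (inj_eq trmx_inj).
set u := (frob x)^-1 *: x^T; set v := (frob y)^-1 *: y.
have uu : u^T *m u = 1%:M by rewrite /u -frob_tr; exact: normalized_col.
have vv : v^T *m v = 1%:M by exact: normalized_col.
have fu : frob u = 1.
  by rewrite frobZ frob_tr gtr0_norm ?invr_gt0// mulVf// gt_eqF.
have fv : frob v = 1 by rewrite frobZ gtr0_norm ?invr_gt0// mulVf// gt_eqF.
have xE : x = frob x *: u^T.
  by rewrite /u linearZ /= trmxK scalerA divff ?gt_eqF// scale1r.
have yE : y = frob y *: v by rewrite /v scalerA divff ?gt_eqF// scale1r.
set A' := A - u *m (u^T *m A); set B' := B - (B *m v) *m v^T.
have xA' : x *m A' = 0.
  by rewrite xE -scalemxAl /A' mulmxBr !mulmxA uu mul1mx subrr scaler0.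
have B'y : B' *m y = 0.
  by rewrite yE -scalemxAr /B' mulmxBl -!mulmxA vv mulmx1 subrr scaler0.
have YB : Y - A' *m B' = u *m (u^T *m Y) + (Y *m v) *m v^T
    - u *m (u^T *m (Y *m v)) *m v^T.
  have zm (p a b c : 'M[R]_(m, n)) : p - (p - a - (b - c)) = b + a - c.
    by apply/matrixP => i j; rewrite !mxE; ring.
  by rewrite /A' /B' /Y mulmxBl !mulmxBr !mulmxA zm.
have uY : frob (x *m Y) = frob x * frob (u^T *m Y).
  by rewrite [in LHS]xE -scalemxAl frobZ gtr0_norm.
have Yv : frob (Y *m y) = frob y * frob (Y *m v).
  by rewrite [in LHS]yE -[in LHS]scalemxAr frobZ gtr0_norm.
have YB_le : frob (Y - A' *m B') <= frob (u^T *m Y) + 2 * frob (Y *m v).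
  have e1 : frob (u *m (u^T *m Y)) <= frob (u^T *m Y).
    by have := frobM u (u^T *m Y); rewrite fu mul1r.
  have e2 : frob (Y *m v *m v^T) <= frob (Y *m v).
    by have := frobM (Y *m v) v^T; rewrite frob_tr fv mulr1.
  have e3 : frob (u *m (u^T *m (Y *m v)) *m v^T) <= frob (Y *m v).
    apply: le_trans (frobM _ _) _; rewrite frob_tr fv mulr1.
    apply: le_trans (frobM _ _) _; rewrite fu mul1r.
    by have := frobM u^T (Y *m v); rewrite frob_tr fu mul1r.
  rewrite YB; apply: le_trans (frobB _ _) _.
  have := frobD (u *m (u^T *m Y)) (Y *m v *m v^T); lra.
have -> : x *m G Y *m y = x *m G (A' *m B') *m y + x *m (G Y - G (A' *m B')) *m y.
  by rewrite [x *m (G Y - _)]mulmxBr [(_ - _) *m y]mulmxBl [RHS]addrC subrK.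
apply: le_trans (frobD _ _) _; apply: lerD; first exact: normal_component_le.
apply: le_trans (frob_sandwich _ _ _) _.
apply: (@le_trans _ _ (frob x * frob y *
    (L * (frob (u^T *m Y) + 2 * frob (Y *m v))))).
  apply: ler_wpM2l; first by rewrite mulr_ge0// ltW.
  apply: le_trans (G_lipschitz _ _) _; exact: ler_wpM2l.
rewrite uY Yv.
set p := frob (u^T *m Y); set q := frob (Y *m v).
have : 0 <= L * (frob x * frob y * p) by rewrite !mulr_ge0 ?frob_ge0.
lra.
Qed.

End TangencyEstimate.

(** * Splitting of tangent matrices *)

Section TangentSplitting.
Context {R : realType}.
Implicit Types m n : nat.

(** Homogeneous in x and y, so that it is transported by any bounded change of
    basis; for a diagonal Y with entries s_i >= 0 it gives
    |G_ij| <= eps + L (s_i + s_j). *)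
Definition tangency_bound m n (eps L : R) (Y G : 'M[R]_(m, n)) : Prop :=
  forall (x : 'rV[R]_m) (y : 'cV[R]_n),
    frob (x *m G *m y) <= eps * (frob x * frob y) +
      L * (frob (x *m Y) * frob y + frob x * frob (Y *m y)).

(** Approximate membership of G in the tangent space M Y + Y N at Y, with
    generators M and N whose size does not involve the singular values of Y. *)
Definition splits_with m n (c : R) (Y : 'M[R]_(m, n)) : Prop :=
  forall (G : 'M[R]_(m, n)) (eps L : R), 0 <= eps -> 0 <= L ->
  tangency_bound eps L Y G ->
  exists (M : 'M[R]_m) (N : 'M[R]_n) (E : 'M[R]_(m, n)),
    [/\ G = M *m Y + Y *m N + E, frob M <= c * L, frob N <= c * L &
        frob E <= c * eps].

(** Passing to P' Y Q' costs a factor k^2 in the hypothesis and again k^2 in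
    the conclusion. *)
Lemma splits_with_equiv m n (Y : 'M[R]_(m, n)) (P P' : 'M[R]_m)
    (Q Q' : 'M[R]_n) (k c : R) :
  P *m P' = 1%:M -> Q' *m Q = 1%:M ->
  frob P <= k -> frob P' <= k -> frob Q <= k -> frob Q' <= k -> 0 <= c ->
  splits_with c (P' *m Y *m Q') -> splits_with (k ^+ 4 * c) Y.
Proof.
move=> PP' Q'Q Pk P'k Qk Q'k c0 Y1split G eps L eps0 L0 YG.
have k0 : 0 <= k by exact: le_trans (frob_ge0 _) Pk.
have k2 : 0 <= k ^+ 2 by exact: sqr_ge0.
have [||x y|M [N [E [GE Mc Nc Ec]]]] :=
    Y1split (P' *m G *m Q') (k ^+ 2 * eps) (k ^+ 2 * L).
- exact: mulr_ge0.
- exact: mulr_ge0.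
- have xP' : frob (x *m P') <= frob x * k.
    by apply: le_trans (frobM _ _) _; rewrite ler_wpM2l ?frob_ge0.
  have Q'y : frob (Q' *m y) <= k * frob y.
    by apply: le_trans (frobM _ _) _; rewrite ler_wpM2r ?frob_ge0.
  have xY : frob (x *m P' *m Y) <= frob (x *m (P' *m Y *m Q')) * k.
    have -> : x *m P' *m Y = x *m (P' *m Y *m Q') *m Q.
      by rewrite !mulmxA -[RHS]mulmxA Q'Q mulmx1.
    by apply: le_trans (frobM _ _) _; rewrite ler_wpM2l ?frob_ge0.
  have Yy : frob (Y *m (Q' *m y)) <= k * frob (P' *m Y *m Q' *m y).
    have -> : Y *m (Q' *m y) = P *m (P' *m Y *m Q' *m y).
      by rewrite !mulmxA PP' mul1mx.
    by apply: le_trans (frobM _ _) _; rewrite ler_wpM2r ?frob_ge0.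
  have := YG (x *m P') (Q' *m y).
  rewrite !mulmxA => /le_trans; apply; apply: lerD.
    rewrite [k ^+ 2 * eps]mulrC -mulrA; apply: ler_wpM2l => //.
    apply: (le_trans (ler_pM _ _ xP' Q'y)); rewrite ?frob_ge0//.
    by rewrite le_eqVlt; apply/orP; left; apply/eqP; ring.
  rewrite [k ^+ 2 * L]mulrC -mulrA; apply: ler_wpM2l => //.
  rewrite mulrDr; apply: lerD.
        apply: (le_trans (ler_pM _ _ xY Q'y)); rewrite ?frob_ge0// !mulmxA.
    by rewrite le_eqVlt; apply/orP; left; apply/eqP; ring.
    rewrite -[Y *m Q' *m y]mulmxA.
  apply: (le_trans (ler_pM _ _ xP' Yy)); rewrite ?frob_ge0//.
  by rewrite le_eqVlt; apply/orP; left; apply/eqP; ring.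
have sandwich_le p q (X : 'M[R]_p) (Z : 'M[R]_(p, q)) (W : 'M[R]_q) a :
    frob X <= k -> frob W <= k -> frob Z <= c * (k ^+ 2 * a) ->
    frob (X *m Z *m W) <= k ^+ 4 * c * a.
  move=> Xk Wk Za; apply: le_trans (frob_sandwich _ _ _) _.
  have -> : k ^+ 4 * c * a = k * k * (c * (k ^+ 2 * a)) by ring.
  by rewrite !ler_pM ?mulr_ge0 ?frob_ge0.
exists (P *m M *m P'), (Q' *m N *m Q), (P *m E *m Q); split.
- have -> : G = P *m (P' *m G *m Q') *m Q.
    by rewrite !mulmxA PP' mul1mx -mulmxA Q'Q mulmx1.
  rewrite GE !mulmxDr !mulmxDl !mulmxA PP' mul1mx.
  by rewrite -[_ *m Q' *m Q]mulmxA Q'Q mulmx1.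
- exact: sandwich_le.
- exact: sandwich_le.
- exact: sandwich_le.
Qed.

Lemma tangency_bound_entry m n (eps L : R) (Y G : 'M[R]_(m, n)) i j :
  tangency_bound eps L Y G ->
  `|G i j| <= eps + L * (frob (row i Y) + frob (col j Y)).
Proof.
move=> /(_ (delta_mx 0 i) (delta_mx j 0)).
have frob_delta p q (i' : 'I_p) (j' : 'I_q) : frob (delta_mx i' j' : 'M[R]_(p, q)) = 1.
  rewrite /frob (bigD1 i')//= (bigD1 j')//= mxE !eqxx expr1n !big1 ?addr0 ?sqrtr1//.
    move=> a ai; rewrite big1// => b _.
    by rewrite mxE (negbTE ai) expr0n.
  by move=> b bj; rewrite mxE (negbTE bj) andbF expr0n.
rewrite !frob_delta -!rowE -!colE !mulr1 mul1r; apply: le_trans.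
have -> : G i j = (col j (row i G)) 0 0 by rewrite !mxE.
exact: entry_le_frob.
Qed.

Lemma frob_row0_mx m n1 n2 (X : 'M[R]_(m, n2)) :
  frob (row_mx (0 : 'M[R]_(m, n1)) X) = frob X.
Proof.
rewrite /frob; congr Num.sqrt; apply: eq_bigr => i _.
rewrite big_split_ord /= big1 ?add0r; last first.
  by move=> j _; rewrite row_mxEl mxE expr0n.
by apply: eq_bigr => j _; rewrite row_mxEr.
Qed.

Lemma frob_col0_mx m1 m2 n (X : 'M[R]_(m2, n)) :
  frob (col_mx (0 : 'M[R]_(m1, n)) X) = frob X.
Proof. by rewrite -frob_tr tr_col_mx trmx0 frob_row0_mx frob_tr. Qed.

Lemma block_entry_le m1 m2 n1 n2 (A : 'M[R]_(m1, n1)) (B : 'M[R]_(m1, n2))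
    (C : 'M[R]_(m2, n1)) (D : 'M[R]_(m2, n2)) (e : R) :
  (forall i j, `|A i j| <= e) -> (forall i j, `|B i j| <= e) ->
  (forall i j, `|C i j| <= e) -> (forall i j, `|D i j| <= e) ->
  forall i j, `|block_mx A B C D i j| <= e.
Proof.
move=> Ae Be Ce De i j.
rewrite -[i]splitK -[j]splitK.
case: (fintype.split i) => i'; case: (fintype.split j) => j' /=.
- by rewrite block_mxEul.
- by rewrite block_mxEur.
- by rewrite block_mxEdl.
- by rewrite block_mxEdr.
Qed.

Lemma split_by_scalar p q (X : 'M[R]_(p, q)) (a e l : R) :
  0 <= e -> 0 <= l -> (forall i j, `|X i j| <= e + l * `|a|) ->
  exists N E : 'M[R]_(p, q),
    [/\ X = a *: N + E, (forall i j, `|N i j| <= l) & forall i j, `|E i j| <= e].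
Proof.
move=> e0 l0; set w := e + l * `|a| => Xw.
have w0 : 0 <= w by rewrite addr_ge0 ?mulr_ge0.
have scaled_le b i j : 0 <= b -> `|b / w * X i j| <= b.
  move=> b0; rewrite normrM ger0_norm ?divr_ge0//.
  have [w_eq0|w_neq0] := eqVneq w 0; first by rewrite w_eq0 invr0 mulr0 mul0r.
  apply: le_trans (ler_wpM2l _ (Xw i j)) _; first exact: divr_ge0.
  by rewrite mulfVK.
(* X is divided in the proportion of the two terms of w = e + l |a|; when
   w = 0 the convention 0^-1 = 0 gives N = E = 0 = X. *)
exists ((Num.sg a * (l / w)) *: X), ((e / w) *: X); split.
- apply/matrixP => i j; rewrite !mxE.
  have [w_eq0|w_neq0] := eqVneq w 0.
    have : `|X i j| <= 0 by rewrite -w_eq0.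
    by rewrite normr_le0 => /eqP ->; rewrite !mulr0 addr0.
  have -> : a * (Num.sg a * (l / w) * X i j) + e / w * X i j
      = (e + l * (Num.sg a * a)) / w * X i j by ring.
  by rewrite -normrEsg divff// mul1r.
- move=> i j; rewrite mxE -mulrA normrM; apply: le_trans (scaled_le l i j l0).
  apply: ler_piMl => //.
  by rewrite normr_sg; case: (a != 0).
- by move=> i j; rewrite mxE scaled_le.
Qed.

(** The pivot row and column of a tangent matrix are bounded by the pivot
    alone, because the pivot dominates Y'; so a times a bounded matrix, plus
    an O(eps) remainder, reproduces them. Only the trailing block depends
    on Y'. *)
Lemma splits_with_pivot m n (a c : R) (Y' : 'M[R]_(m, n)) : 0 <= c ->
  (forall i j, `|Y' i j| <= 2 * `|a|) -> splits_with c Y' ->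
  let K := (4 + 2 * (m + n)%:R + c) * ((1 + m) + (1 + n))%:R ^+ 2 in
  splits_with K (block_mx a%:M 0 0 Y' : 'M[R]_(1 + m, 1 + n)).
Proof.
move=> c0 Y'a Y'c K G eps L eps0 L0.
set D := block_mx _ _ _ _ => DG.
have Da i j : `|D i j| <= 2 * `|a|.
  apply: block_entry_le => // {}i {}j; rewrite mxE ?normr0 ?mulr_ge0//.
  by rewrite !ord1 eqxx mulr1n; have := normr_ge0 a; lra.
set kap : R := 2 + (m + n)%:R.
have Gij i j : `|G i j| <= eps + L * (2 * kap) * `|a|.
  apply: (le_trans (tangency_bound_entry i j DG)); rewrite lerD2l -[leRHS]mulrA.
  apply: ler_wpM2l => //.
  have ri : frob (row i D) <= (1 * (1 + n))%:R * (2 * `|a|).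
    by apply: frob_le_entries => [|? ?]; rewrite ?mulr_ge0// mxE.
  have cj : frob (col j D) <= ((1 + m) * 1)%:R * (2 * `|a|).
    by apply: frob_le_entries => [|? ?]; rewrite ?mulr_ge0// mxE.
  apply: le_trans (lerD ri cj) _.
  rewrite mul1n muln1 /kap !natrD; lra.
have l0 : 0 <= L * (2 * kap) by rewrite !mulr_ge0// addr_ge0.
have [|n11 [E11 [G11E n11l E11e]]] := split_by_scalar (a := a) (X := ulsubmx G) eps0 l0.
  by move=> i j; rewrite !mxE.
have [|n12 [E12 [G12E n12l E12e]]] := split_by_scalar (a := a) (X := ursubmx G) eps0 l0.
  by move=> i j; rewrite !mxE.
have [|m21 [E21 [G21E m21l E21e]]] := split_by_scalar (a := a) (X := dlsubmx G) eps0 l0.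
  by move=> i j; rewrite !mxE.
have [|M22 [N22 [E22 [G22E M22c N22c E22c]]]] := Y'c (drsubmx G) eps L eps0 L0.
  move=> x y; have := DG (row_mx 0 x) (col_mx 0 y).
  rewrite frob_row0_mx frob_col0_mx -[G in _ *m G *m _]submxK.
  rewrite !mul_row_block !mul_row_col !mul_block_col !mulmx0 !mul0mx !add0r.
  by rewrite frob_row0_mx frob_col0_mx.
have kap0 : 0 <= kap by rewrite addr_ge0.
have S_le k l : (k <= 1 + m + (1 + n))%N -> (l <= 1 + m + (1 + n))%N ->
    ((k * l)%:R : R) <= (1 + m + (1 + n))%:R ^+ 2.
  by move=> kS lS; rewrite -natrX ler_nat leq_mul.
have K_le k l (X : 'M[R]_(k, l)) b :
    (k <= 1 + m + (1 + n))%N -> (l <= 1 + m + (1 + n))%N -> 0 <= b ->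
    (forall i j, `|X i j| <= (2 * kap + c) * b) -> frob X <= K * b.
  move=> kS lS b0 Xb; have kc0 : 0 <= (2 * kap + c) * b.
    by rewrite mulr_ge0// addr_ge0// mulr_ge0.
  apply: (le_trans (frob_le_entries kc0 Xb)).
  have -> : K * b = (1 + m + (1 + n))%:R ^+ 2 * ((2 * kap + c) * b).
    by rewrite /K /kap; ring.
  by apply: ler_wpM2r => //; exact: S_le.
have cL : c * L <= (2 * kap + c) * L by apply: ler_wpM2r => //; rewrite lerDr mulr_ge0.
have ce : c * eps <= (2 * kap + c) * eps.
  by apply: ler_wpM2r => //; rewrite lerDr mulr_ge0.
have lL : L * (2 * kap) <= (2 * kap + c) * L.
  by rewrite mulrC; apply: ler_wpM2r => //; rewrite lerDl.
have le_eps : eps <= (2 * kap + c) * eps.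
  rewrite -[leLHS]mul1r; apply: ler_wpM2r => //.
  by have : 0 <= (m + n)%:R :> R by []; rewrite /kap; lra.
have sz0 b : 0 <= b -> 0 <= (2 * kap + c) * b.
  by move=> b0; rewrite mulr_ge0// addr_ge0// mulr_ge0.
(* The pivot row is produced by N alone and the pivot column by M alone, so
   that neither of them interferes with the trailing block. *)
exists (block_mx 0 0 m21 M22), (block_mx n11 n12 0 N22), (block_mx E11 E12 E21 E22).
split.
- rewrite !mulmx_block !mul0mx !mulmx0 !(add0r, addr0) !add_block_mx !add0r.
  rewrite !mul_scalar_mx !mul_mx_scalar addr0 -G11E -G12E -G21E -G22E.
  by rewrite submxK.
- apply: K_le => //; rewrite ?leq_addr//; apply: block_entry_le => i j.
  + by rewrite mxE normr0 sz0.
  + by rewrite mxE normr0 sz0.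
  + exact: le_trans (m21l i j) lL.
  + exact: le_trans (entry_le_frob _ _ _) (le_trans M22c cL).
- apply: K_le => //; rewrite ?leq_addl//; apply: block_entry_le => i j.
  + exact: le_trans (n11l i j) lL.
  + exact: le_trans (n12l i j) lL.
  + by rewrite mxE normr0 sz0.
  + exact: le_trans (entry_le_frob _ _ _) (le_trans N22c cL).
- apply: K_le; rewrite ?leq_addr ?leq_addl//; apply: block_entry_le => i j.
  + exact: le_trans (E11e i j) le_eps.
  + exact: le_trans (E12e i j) le_eps.
  + exact: le_trans (E21e i j) le_eps.
  + exact: le_trans (entry_le_frob _ _ _) (le_trans E22c ce).
Qed.

Lemma frob_tperm_mx m (i j : 'I_m) : frob (tperm_mx i j : 'M[R]_m) <= (m * m)%:R.
Proof.
rewrite -[leRHS]mulr1; apply: frob_le_entries => // k l.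
by rewrite !mxE; case: eqP; rewrite ?normr0 ?normr1.
Qed.

Lemma tperm_mx_sqr m (i j : 'I_m) : tperm_mx i j *m tperm_mx i j = 1%:M :> 'M[R]_m.
Proof. by rewrite -perm_mxM perm.tperm2 perm_mx1. Qed.

(** Gaussian elimination with complete pivoting. The multipliers are at most 1
    in absolute value, so every change of basis is bounded independently of
    the conditioning of Y; this is what makes c depend on the size only. *)
Lemma tangent_splitting m n :
  exists2 c : R, 0 <= c & forall Y : 'M[R]_(m, n), splits_with c Y.
Proof.
elim: m n => [|m IHm] n.
  exists 0 => // Y G eps L _ _ _; exists 0, 0, 0.
  by rewrite !frob0 !mul0r mul0mx mulmx0 !addr0; split=> //; exact: flatmx0.
case: n => [|n].
  exists 0 => // Y G eps L _ _ _; exists 0, 0, 0.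
  by rewrite !frob0 !mul0r mul0mx mulmx0 !addr0; split=> //; exact: thinmx0.
have [c c0 Yc] := IHm n.
set S : R := (1 + m + (1 + n))%:R.
set K : R := (4 + 2 * (m + n)%:R + c) * S ^+ 2.
have S1 : 1 <= S by rewrite /S ler1n.
have K0 : 0 <= K by rewrite mulr_ge0 ?exprn_ge0 ?addr_ge0 ?mulr_ge0.
set k : R := S ^+ 2.
have k1 : 1 <= k by rewrite exprn_ege1.
have k0 : 0 <= k by exact: le_trans k1.
have k4 : 0 <= k ^+ 4 by exact: exprn_ge0.
have kK0 : 0 <= k ^+ 4 * K by exact: mulr_ge0.
have c'0 : 0 <= k ^+ 4 * (k ^+ 4 * K) by exact: mulr_ge0.
have size_le (p q : nat) : (p <= 1 + m + (1 + n))%N -> (q <= 1 + m + (1 + n))%N ->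
    ((p * q)%:R : R) <= k.
  by move=> pS qS; rewrite /k /S -natrX ler_nat leq_mul.
exists (k ^+ 4 * (k ^+ 4 * K)) => // Y.
have pivot_step (a : R) (b : 'rV[R]_n) (d : 'cV[R]_m) (Z : 'M[R]_(m, n)) :
    a != 0 -> (forall i j, `|b i j| <= `|a|) -> (forall i j, `|d i j| <= `|a|) ->
    (forall i j, `|Z i j| <= `|a|) ->
    splits_with (k ^+ 4 * K) (block_mx a%:M b d Z : 'M[R]_(1 + m, 1 + n)).
  move=> a0 ba da Za.
  pose P s : 'M[R]_(1 + m) := block_mx 1%:M 0 (s *: d) 1%:M.
  pose Q s : 'M[R]_(1 + n) := block_mx 1%:M (s *: b) 0 1%:M.
  have scaled_le s p q (X : 'M[R]_(p, q)) : `|s| = `|a|^-1 ->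
      (forall i j, `|X i j| <= `|a|) -> forall i j, `|(s *: X) i j| <= 1.
    by move=> sa Xa i j; rewrite mxE normrM sa ler_pdivrMl ?normr_gt0// mulr1.
  have le1 p i j : `|(1%:M : 'M[R]_p) i j| <= 1.
    by rewrite mxE; case: eqP; rewrite ?normr0 ?normr1.
  have le0 p q i j : `|(0 : 'M[R]_(p, q)) i j| <= 1 by rewrite mxE normr0.
  have Pk s : `|s| = `|a|^-1 -> frob (P s) <= k.
    move=> sa; apply: (@le_trans _ _ (((1 + m) * (1 + m))%:R * 1)).
      by apply: frob_le_entries => //; apply: block_entry_le => //; exact: scaled_le.
    by rewrite mulr1 size_le// leq_addr.
  have Qk s : `|s| = `|a|^-1 -> frob (Q s) <= k.
    move=> sa; apply: (@le_trans _ _ (((1 + n) * (1 + n))%:R * 1)).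
      by apply: frob_le_entries => //; apply: block_entry_le => //; exact: scaled_le.
    by rewrite mulr1 size_le// leq_addl.
  have PP : P a^-1 *m P (- a^-1) = 1%:M.
    rewrite mulmx_block !mul1mx !mul0mx !mulmx1 !mulmx0 !addr0 add0r.
    by rewrite -scalerDl subrr scale0r -scalar_mx_block.
  have QQ : Q (- a^-1) *m Q a^-1 = 1%:M.
    rewrite mulmx_block !mul1mx !mul0mx !mulmx1 !mulmx0 !addr0 add0r.
    by rewrite -scalerDl subrr scale0r -scalar_mx_block.
  have sa : `|a^-1| = `|a|^-1 by rewrite normfV.
  have sNa : `|- a^-1| = `|a|^-1 by rewrite normrN.
  apply: (splits_with_equiv PP QQ); rewrite ?Pk ?Qk//.
  have -> : P (- a^-1) *m block_mx a%:M b d Z *m Q (- a^-1) =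
      block_mx a%:M 0 0 (Z - a^-1 *: (d *m b)).
    rewrite !mulmx_block !mul1mx !mul0mx !mulmx1 !mulmx0 !addr0.
    have -> : (- a^-1 *: d) *m a%:M = - d.
      by rewrite mul_mx_scalar scalerA mulrN mulfV// scaleN1r.
    have -> : a%:M *m (- a^-1 *: b) = - b.
      by rewrite mul_scalar_mx scalerA mulrN mulfV// scaleN1r.
    rewrite !addNr mul0mx add0r -scalemxAl scaleNr.
    by rewrite [- _ + Z]addrC.
  apply: splits_with_pivot => // i j; rewrite !mxE big_ord1.
  apply: le_trans (ler_normB _ _) _; rewrite mulr_natl mulr2n.
  apply: lerD => //; rewrite mulrA normrM -[leRHS]mul1r.
  apply: ler_pM => //; have := scaled_le _ _ _ d sa da i 0; by rewrite mxE.
have [->|Y0] := eqVneq Y 0.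
  move=> G eps L eps0 L0 YG; exists 0, 0, G.
  rewrite !frob0 mul0mx mul0mx !add0r; split=> //; [exact: mulr_ge0|exact: mulr_ge0|].
  have Ge i j : `|G i j| <= eps.
    apply: (le_trans (tangency_bound_entry i j YG)).
    by rewrite linear0 linear0 !frob0 addr0 mulr0 addr0.
  apply: (le_trans (frob_le_entries eps0 Ge)); apply: ler_wpM2r => //.
  have kX4 : 1 <= k ^+ 4 by rewrite exprn_ege1.
  have K1 : 1 <= K.
    rewrite /K -[1]mulr1; apply: ler_pM => //.
    by have : 0 <= (m + n)%:R :> R by []; lra.
  have -> : k ^+ 4 * (k ^+ 4 * K) = k * (k ^+ 3 * (k ^+ 4 * K)) by ring.
  apply: (@le_trans _ _ (k * 1)).
    by rewrite mulr1 size_le// ?leq_addr ?leq_addl.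
  apply: ler_wpM2l => //.
  rewrite -[1]mulr1; apply: ler_pM => //; first exact: exprn_ege1.
  by rewrite -[1]mulr1; apply: ler_pM.
case: (@arg_maxP _ _ _ (ord0, ord0) xpredT
  (fun p : 'I_m.+1 * 'I_n.+1 => `|Y p.1 p.2|)) => //.
move=> [i0 j0] _ Ymax.
have Pk (p : nat) (i j : 'I_p) : (p <= 1 + m + (1 + n))%N ->
    frob (tperm_mx i j : 'M[R]_p) <= k.
  by move=> pS; apply: (le_trans (frob_tperm_mx _ _)); exact: size_le.
have mS : (m.+1 <= 1 + m + (1 + n))%N by exact: leq_addr.
have nS : (n.+1 <= 1 + m + (1 + n))%N by exact: leq_addl.
apply: (splits_with_equiv (tperm_mx_sqr ord0 i0) (tperm_mx_sqr ord0 j0));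
  rewrite ?Pk//.
rewrite -xrowE -xcolE; set Y1 := xcol _ _ _.
have Y1_le i j : `|Y1 i j| <= `|Y i0 j0| by rewrite !mxE; exact: (Ymax (_, _)).
have Y1_00 : Y1 ord0 ord0 = Y i0 j0 by rewrite !mxE !perm.tpermL.
have a0 : Y i0 j0 != 0.
  apply: contra_neq Y0 => a0; apply/matrixP => i j; rewrite mxE.
  by apply/eqP; rewrite -normr_le0 -[leRHS](normr0 R) -a0; exact: (Ymax (i, j)).
have ulY1 : @ulsubmx _ 1 m 1 n Y1 = (Y i0 j0)%:M.
  rewrite [LHS]mx11_scalar -Y1_00 2!mxE; congr (Y1 _ _)%:M; exact: val_inj.
rewrite -[Y1](@submxK _ 1 m 1 n) ulY1.
apply: pivot_step => // i j; rewrite 2!mxE; exact: Y1_le.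
Qed.

End TangentSplitting.

(** * Real induction *)

(** Real induction: the supremum of the points up to which I has been
    propagated lies strictly below b only if a step straddling it is refused. *)
Lemma straddle_induction (R : realType) (a b : R) (I : R -> Prop) :
  a <= b -> I a ->
  (forall c, a <= c <= b -> exists2 d, 0 < d &
    forall s t, a <= s -> s <= c -> c <= t -> t <= b -> t - s < d -> I s -> I t) ->
  I b.
Proof.
move=> ab Ia step.
pose S := [set x | a <= x <= b /\ I x]%classic.
have Sa : S a by rewrite /S /= lexx ab.
have Sub : has_ubound S by exists b => x [/andP[]].
have Ssup : has_sup S by split => //; exists a.
have ac : a <= sup S by exact: ub_le_sup.
have cb : sup S <= b by apply: ge_sup => [|x [/andP[]]//]; exists a.
have [|d d0 stepc] := step (sup S); first by rewrite ac cb.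
have [|s Ss supSs] := sup_adherent _ Ssup (eps := d / 2); first by rewrite divr_gt0.
have sc : s <= sup S by exact: ub_le_sup.
have [/andP[as_ _] Is] := Ss.
have [bd|bd] := leP b (sup S + d / 3).
  by apply: stepc Is => //; lra.
have It : I (sup S + d / 3) by apply: stepc Is => //; lra.
have : sup S + d / 3 <= sup S.
  by apply: ub_le_sup => //; split=> //; apply/andP; split; lra.
lra.
Qed.

(** A difference quotient over [s, t] is a convex combination of the two
    one-sided quotients at c. *)
Lemma derivative_straddle (R : realType) m n (a b : R) (A : R -> 'M[R]_(m, n))
    (c : R) (D : 'M[R]_(m, n)) :
  has_derivative_on a b A c D -> forall e, 0 < e -> exists2 d, 0 < d &
    forall s t, a <= s -> s <= c -> c <= t -> t <= b -> t - s < d ->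
      frob (A t - A s - (t - s) *: D) <= e * (t - s).
Proof.
move=> AD e e0.
set K : R := (m * n)%:R + 1; have K0 : 0 < K by rewrite ltr_pwDr.
have eK0 : 0 < e / K by rewrite divr_gt0.
move/cvg_ballP: AD => /(_ _ eK0) [d /= d0 near_c].
(* The difference quotient converges entrywise; K pays for the passage from
   entries to the Frobenius norm. *)
have one_sided s : a <= s <= b -> `|s - c| < d ->
    frob (A s - A c - (s - c) *: D) <= e * `|s - c|.
  move=> sab scd.
  have [->|sc] := eqVneq s c.
    by rewrite !subrr scale0r subr0 frob0 normr0 mulr0.
  have := near_c s; rewrite /= distrC in_itv => /(_ scd sc sab) Dq.
  have sc0 : s - c != 0 by rewrite subr_eq0.
  have -> : A s - A c - (s - c) *: D = (s - c) *: ((s - c)^-1 *: (A s - A c) - D).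
    by rewrite scalerBr scalerA divff// scale1r.
  rewrite frobZ mulrC; apply: ler_wpM2r => //.
  apply: (@le_trans _ _ ((m * n)%:R * (e / K))).
    apply: frob_le_entries => [|i j]; first exact: ltW.
    have [_ /(_ i j)] := Dq; rewrite /ball /= distrC => /ltW; apply: le_trans.
    by rewrite !mxE.
  rewrite mulrCA ger_pMr// ler_pdivrMr// mul1r /K; lra.
exists d => // s t as_ sc ct tb tsd.
have -> : A t - A s - (t - s) *: D =
    (A t - A c - (t - c) *: D) - (A s - A c - (s - c) *: D).
  by apply/matrixP => i j; rewrite !mxE; ring.
apply: le_trans (frobB _ _) _.
have Ht : frob (A t - A c - (t - c) *: D) <= e * `|t - c|.
  by apply: one_sided; rewrite ?ger0_norm; try (apply/andP; split); lra.
have Hs : frob (A s - A c - (s - c) *: D) <= e * `|s - c|.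
  by apply: one_sided; rewrite ?ler0_norm; try (apply/andP; split); lra.
rewrite ger0_norm ?subr_ge0// in Ht; rewrite ler0_norm ?subr_le0// in Hs.
lra.
Qed.

(** * Stability and low-rank tracking of trajectories *)

Section Trajectories.
Context {R : realType} {m n : nat}.
Implicit Types (F : R -> 'M[R]_(m, n) -> 'M[R]_(m, n)) (A : R -> 'M[R]_(m, n)).

(** The differential equation in increment form. The tag c at which F is
    evaluated lies anywhere between s and t, as real induction requires. *)
Definition straddle_solution F (a b : R) A : Prop :=
  forall c, a <= c <= b -> forall e, 0 < e -> exists2 d, 0 < d &
    forall s t, a <= s -> s <= c -> c <= t -> t <= b -> t - s < d ->
      frob (A t - A s - (t - s) *: F c (A c)) <= e * (t - s).

Lemma solves_ivp_straddle F (a b : R) X0 A :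
  solves_ivp F a b X0 A -> straddle_solution F a b A.
Proof. by move=> [_ AF] c cab; apply: derivative_straddle; exact: AF. Qed.

Lemma straddle_solution_shift F (a b u h : R) A :
  a <= u -> u + h <= b -> straddle_solution F a b A ->
  straddle_solution (fun s => F (u + s)) 0 h (fun s => A (u + s)).
Proof.
move=> au uhb AF c /andP[c0 ch] e e0.
have [|d d0 dH] := AF (u + c) _ e e0; first by apply/andP; split; lra.
exists d => // s t s0 sc ct th tsd.
have -> : t - s = (u + t) - (u + s) by ring.
by apply: dH; lra.
Qed.

Lemma straddle_solution_continuous F (a b : R) A :
  straddle_solution F a b A -> forall c, a <= c <= b -> forall e, 0 < e ->
  exists2 d, 0 < d &
    forall s, a <= s -> s <= c -> c - s < d -> frob (A c - A s) <= e.
Proof.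
move=> AF c /[dup] cab /andP[ac cb] e e0.
have [d d0 dH] := AF c cab 1 ltr01.
set w := frob (F c (A c)); have w0 : 0 < 1 + w by rewrite ltr_pwDl ?frob_ge0.
exists (Num.min d (e / (1 + w))); first by rewrite lt_min d0 divr_gt0.
move=> s as_ sc; rewrite lt_min => /andP[csd cse].
have := dH s c as_ sc (lexx c) cb csd; rewrite mul1r => step.
have -> : A c - A s = (A c - A s - (c - s) *: F c (A c)) + (c - s) *: F c (A c).
  by rewrite subrK.
apply: le_trans (frobD _ _) _; rewrite frobZ ger0_norm ?subr_ge0//.
apply: (@le_trans _ _ ((c - s) * (1 + w))); first by rewrite mulrDr mulr1 lerD2r.
by rewrite -ler_pdivlMr// ltW.
Qed.

(** Not the sharp solution of u' = L u + g, but an upper bound for it that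
    survives the Euler steps below. *)
Definition gronwall_bound (L g u0 x : R) : R := expR (L * x) * (u0 + g * x).

Lemma gronwall_bound_step (L g u0 s t x : R) :
  0 <= L -> 0 <= g -> 0 <= u0 -> 0 <= s -> s <= t ->
  x <= gronwall_bound L g u0 s ->
  (1 + L * (t - s)) * x + g * (t - s) <= gronwall_bound L g u0 t.
Proof.
move=> L0 g0 u0_ge0 s0 st xE.
have ts0 : 0 <= t - s by lra.
have Lts0 : 0 <= L * (t - s) by exact: mulr_ge0.
have E0 : 0 <= gronwall_bound L g u0 s.
  by rewrite mulr_ge0 ?expR_ge0// addr_ge0// mulr_ge0.
have -> : gronwall_bound L g u0 t =
    expR (L * (t - s)) * gronwall_bound L g u0 s + expR (L * t) * (g * (t - s)).
  rewrite /gronwall_bound mulrA -expRD.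
  have -> : L * (t - s) + L * s = L * t by ring.
  by ring.
apply: lerD.
  apply: (@le_trans _ _ ((1 + L * (t - s)) * gronwall_bound L g u0 s)).
    by apply: ler_wpM2l => //; lra.
  by apply: ler_wpM2r => //; exact: expR_ge1Dx.
rewrite -[leLHS]mul1r; apply: ler_wpM2r; first exact: mulr_ge0.
apply: le_trans (expR_ge1Dx _); rewrite lerDl mulr_ge0//; lra.
Qed.

Lemma gronwall_bound_mono (L g u0 s t : R) :
  0 <= L -> 0 <= g -> 0 <= u0 -> 0 <= s -> s <= t ->
  gronwall_bound L g u0 s <= gronwall_bound L g u0 t.
Proof.
move=> L0 g0 u0_ge0 s0 st; have ts0 : 0 <= t - s by lra.
apply: le_trans (gronwall_bound_step L0 g0 u0_ge0 s0 st (lexx _)).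
have E0 : 0 <= gronwall_bound L g u0 s.
  by rewrite mulr_ge0 ?expR_ge0// addr_ge0// mulr_ge0.
rewrite mulrDl mul1r -addrA lerDl.
by apply: addr_ge0; apply: mulr_ge0 => //; exact: mulr_ge0.
Qed.

Lemma stability F (L h : R) A B :
  0 <= L -> 0 <= h ->
  (forall t X Z, 0 <= t <= h -> frob (F t X - F t Z) <= L * frob (X - Z)) ->
  straddle_solution F 0 h A -> straddle_solution F 0 h B ->
  frob (A h - B h) <= expR (L * h) * frob (A 0 - B 0).
Proof.
move=> L0 h0 FL AF BF.
apply: (@le_of_slack _ _ _ (expR (L * h) * h)); first by rewrite mulr_ge0 ?expR_ge0.
move=> eta eta0; set u0 := frob (A 0 - B 0).
have u0_ge0 : 0 <= u0 by exact: frob_ge0.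
have -> : expR (L * h) * u0 + expR (L * h) * h * eta = gronwall_bound L eta u0 h.
  by rewrite /gronwall_bound; ring.
pose I s := frob (A s - B s) <= gronwall_bound L eta u0 s.
suff : I h by [].
apply: (@straddle_induction _ 0 h I) => //.
  by rewrite /I /gronwall_bound !mulr0 expR0 mul1r addr0.
move=> c /[dup] cab /andP[c0 ch].
set e := eta / (2 + 2 * L); have L2 : 0 < 2 + 2 * L by lra.
have e0 : 0 < e by rewrite divr_gt0.
have eE : 2 * e + 2 * L * e = eta.
  by rewrite /e; field; rewrite gt_eqF.
have [d1 d1_gt0 dA] := AF c cab e e0.
have [d2 d2_gt0 dB] := BF c cab e e0.
have [d3 d3_gt0 cA] := straddle_solution_continuous AF cab e0.
have [d4 d4_gt0 cB] := straddle_solution_continuous BF cab e0.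
exists (Num.min (Num.min d1 d2) (Num.min d3 d4)).
  by rewrite !lt_min d1_gt0 d2_gt0 d3_gt0 d4_gt0.
move=> s t s0 sc ct th; rewrite !lt_min -andbA => /and4P[td1 td2 td3 td4] Is.
have st : s <= t by exact: le_trans ct.
have ts0 : 0 <= t - s by lra.
apply: le_trans (gronwall_bound_step L0 (ltW eta0) u0_ge0 s0 st Is).
have uc : frob (A c - B c) <= frob (A s - B s) + 2 * e.
  have -> : A c - B c = (A s - B s) + ((A c - A s) - (B c - B s)).
    by apply/matrixP => i j; rewrite !mxE; ring.
  apply: le_trans (frobD _ _) _; rewrite lerD2l.
  apply: le_trans (frobB _ _) _.
  have cs3 : c - s < d3 by lra.
  have cs4 : c - s < d4 by lra.
  have := cA s s0 sc cs3; have := cB s s0 sc cs4; lra.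
have -> : A t - B t = (A s - B s) + ((A t - A s - (t - s) *: F c (A c)) -
    (B t - B s - (t - s) *: F c (B c))) + (t - s) *: (F c (A c) - F c (B c)).
  by apply/matrixP => i j; rewrite !mxE; ring.
apply: le_trans (frobD _ _) _; rewrite frobZ ger0_norm//.
have h1 := frobD (A s - B s) ((A t - A s - (t - s) *: F c (A c)) -
    (B t - B s - (t - s) *: F c (B c))).
have h2 := frobB (A t - A s - (t - s) *: F c (A c)) (B t - B s - (t - s) *: F c (B c)).
have h3 := dA s t s0 sc ct th td1.
have h4 := dB s t s0 sc ct th td2.
have h5 : (t - s) * frob (F c (A c) - F c (B c)) <=
    (t - s) * (L * (frob (A s - B s) + 2 * e)).
  apply: ler_wpM2l => //; apply: le_trans (FL _ _ _ cab) _.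
  exact: ler_wpM2l.
rewrite -eE; lra.
Qed.

(** A trajectory that starts with its rows in the row space of W
    stays, up to the defect omega, of the form H W Psi: each increment
    multiplies the rank r approximation by 1 + dt M on the left and by
    1 + dt N on the right, and only the right factor has to be kept under
    control. *)
Lemma low_rank_tracking r F (L kap omega h eta : R) A (H0 : 'M[R]_(m, r))
    (W : 'M[R]_(r, n)) :
  0 <= L -> 0 <= kap -> 0 <= omega -> 0 <= h -> 0 < eta ->
  (forall t X Z, 0 <= t <= h -> frob (F t X - F t Z) <= L * frob (X - Z)) ->
  (forall t (X : 'M[R]_(m, r)) (Z : 'M[R]_(r, n)), 0 <= t <= h ->
    exists M N E, [/\ F t (X *m Z) = M *m (X *m Z) + X *m Z *m N + E,
      frob M <= kap, frob N <= kap & frob E <= omega]) ->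
  straddle_solution F 0 h A -> A 0 = H0 *m W ->
  exists (H : 'M[R]_(m, r)) (Psi : 'M[R]_n),
    frob (Psi - 1%:M) <= expR (kap * h) - 1 /\
    frob (A h - H *m W *m Psi) <= gronwall_bound L (omega + eta) 0 h.
Proof.
move=> L0 kap0 omega0 h0 eta0 FL Fsplit AF A0.
set g := omega + eta; have g0 : 0 <= g by rewrite addr_ge0// ltW.
pose I s := exists (H : 'M[R]_(m, r)) (Psi : 'M[R]_n),
    frob (Psi - 1%:M) <= expR (kap * s) - 1 /\
    frob (A s - H *m W *m Psi) <= gronwall_bound L g 0 s.
suff : I h by [].
apply: (@straddle_induction _ 0 h I) => //.
  exists H0, 1%:M.
  by rewrite mulmx1 A0 !subrr !frob0 mulr0 expR0 subrr /gronwall_bound !mulr0 addr0 mulr0.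
move=> c /[dup] cab /andP[c0 ch].
(* eta is shared by the error of the increment, by the distance from A c to
   A s seen through F, and by the second-order term tau^2 M Z N. *)
set e := eta / (3 * (L + 1)).
have L1 : 0 < 3 * (L + 1) by lra.
have e0 : 0 < e by rewrite divr_gt0.
have Le : L * e <= eta / 3.
  have -> : eta / 3 = (L + 1) * e by rewrite /e; field; rewrite gt_eqF//; lra.
  by apply: ler_wpM2r; lra.
set Eb := gronwall_bound L g 0 h.
set Kb := frob (A c) + e + Eb.
have Eb0 : 0 <= Eb by rewrite mulr_ge0 ?expR_ge0// add0r mulr_ge0.
have Kb0 : 0 <= Kb by rewrite !addr_ge0 ?frob_ge0// ltW.
have kK0 : 0 <= kap * kap * Kb by rewrite !mulr_ge0.
have kK1 : 0 < 3 * (kap * kap * Kb + 1) by lra.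
have e3 : 0 < eta / 3 by lra.
have [d1 d1_gt0 dA] := AF c cab _ e3.
have [d2 d2_gt0 cA] := straddle_solution_continuous AF cab e0.
exists (Num.min (Num.min d1 d2) (eta / (3 * (kap * kap * Kb + 1)))).
  by rewrite !lt_min d1_gt0 d2_gt0 divr_gt0.
move=> s t s0 sc ct th; rewrite !lt_min -andbA => /and3P[td1 td2 td3].
move=> [H [Psi [Psi1 HPsi]]].
have st : s <= t by exact: le_trans ct.
have ts0 : 0 <= t - s by lra.
set tau := t - s in ts0 td1 td2 td3 *.
have tauk0 : 0 <= tau * kap by exact: mulr_ge0.
have tauK : tau * (kap * kap * Kb) <= eta / 3.
  have : tau * (3 * (kap * kap * Kb + 1)) <= eta by rewrite -ler_pdivlMr// ltW.
  lra.
have [M [N [E [FZ Mk Nk Eo]]]] := Fsplit c H (W *m Psi) cab.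
rewrite mulmxA in FZ; set Z := H *m W *m Psi in FZ HPsi.
have cs_tau : c - s <= tau by rewrite /tau lerD2r.
have Acs : frob (A c - A s) <= e by apply: cA => //; lra.
have Zle : frob Z <= Kb.
  have -> : Z = A c - (A c - A s) - (A s - Z) by rewrite !subKr.
  apply: le_trans (frobB _ _) _; rewrite lerD//.
    by apply: le_trans (frobB _ _) _; rewrite lerD2l.
  by apply: le_trans HPsi _; apply: gronwall_bound_mono => //; lra.
exists ((1%:M + tau *: M) *m H), (Psi *m (1%:M + tau *: N)); split.
  have -> : Psi *m (1%:M + tau *: N) - 1%:M =
      (Psi - 1%:M) + (tau *: N + tau *: ((Psi - 1%:M) *m N)).
    rewrite mulmxDr mulmx1 mulmxBl mul1mx -scalemxAr scalerBr.
    by apply/matrixP => i j; rewrite !mxE; ring.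
  set p := frob (Psi - 1%:M) in Psi1.
  apply: (@le_trans _ _ (p + (tau * kap + tau * kap * p))).
    apply: le_trans (frobD _ _) _; rewrite lerD2l.
    apply: le_trans (frobD _ _) _; rewrite !frobZ ger0_norm// -mulrA.
    apply: lerD; first exact: ler_wpM2l.
    apply: ler_wpM2l => //; apply: le_trans (frobM _ _) _; rewrite mulrC.
    by apply: ler_wpM2r => //; exact: frob_ge0.
  have -> : kap * t = tau * kap + kap * s by rewrite /tau; ring.
  rewrite expRD.
  apply: (@le_trans _ _ ((1 + tau * kap) * expR (kap * s) - 1)).
    have -> : p + (tau * kap + tau * kap * p) = (1 + tau * kap) * (p + 1) - 1 by ring.
    by rewrite lerD2r; apply: ler_wpM2l; lra.
  by rewrite lerD2r; apply: ler_wpM2r; rewrite ?expR_ge0// expR_ge1Dx.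
apply: le_trans (gronwall_bound_step L0 g0 (lexx _) s0 st HPsi).
rewrite -/tau.
have -> : A t - (1%:M + tau *: M) *m H *m W *m (Psi *m (1%:M + tau *: N)) =
    (A s - Z) + (A t - A s - tau *: F c (A c)) + tau *: (F c (A c) - F c Z)
    + tau *: E - (tau * tau) *: (M *m Z *m N).
  have -> : (1%:M + tau *: M) *m H *m W *m (Psi *m (1%:M + tau *: N)) =
      Z + tau *: (M *m Z) + tau *: (Z *m N) + (tau * tau) *: (M *m Z *m N).
    have -> : (1%:M + tau *: M) *m H *m W *m (Psi *m (1%:M + tau *: N)) =
        (1%:M + tau *: M) *m Z *m (1%:M + tau *: N) by rewrite /Z !mulmxA.
    rewrite mulmxDr mulmx1 mulmxDl mul1mx -!scalemxAr -!scalemxAl.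
    by rewrite mulmxDl scalerDr -scalemxAl scalerA addrA.
  rewrite [F c Z]FZ; move: (M *m Z) (Z *m N) (M *m Z *m N) (F c (A c)) => p q w v.
  by apply/matrixP => i j; rewrite !mxE; ring.
have h1 := frobB ((A s - Z) + (A t - A s - tau *: F c (A c)) +
  tau *: (F c (A c) - F c Z) + tau *: E) ((tau * tau) *: (M *m Z *m N)).
have h2 := frobD ((A s - Z) + (A t - A s - tau *: F c (A c)) +
  tau *: (F c (A c) - F c Z)) (tau *: E).
have h3 := frobD ((A s - Z) + (A t - A s - tau *: F c (A c)))
  (tau *: (F c (A c) - F c Z)).
have h4 := frobD (A s - Z) (A t - A s - tau *: F c (A c)).
have h5 : frob (A t - A s - tau *: F c (A c)) <= eta / 3 * tau by exact: dA.
have h6 : frob (tau *: (F c (A c) - F c Z)) <= tau * (L * (frob (A s - Z) + e)).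
  rewrite frobZ ger0_norm//; apply: ler_wpM2l => //.
  apply: le_trans (FL _ _ _ cab) _; apply: ler_wpM2l => //.
  by have := frob_sub (A c) (A s) Z; lra.
have h7 : frob (tau *: E) <= tau * omega by rewrite frobZ ger0_norm//; exact: ler_wpM2l.
have h8 : frob ((tau * tau) *: (M *m Z *m N)) <= tau * (eta / 3).
  rewrite frobZ ger0_norm ?mulr_ge0// -mulrA; apply: ler_wpM2l => //.
  apply: le_trans tauK; apply: ler_wpM2l => //.
  apply: le_trans (frob_sandwich _ _ _) _.
  by apply: ler_pM; rewrite ?mulr_ge0 ?frob_ge0//; apply: ler_pM; rewrite ?frob_ge0.
have h9 : tau * (L * e) <= tau * (eta / 3) by exact: ler_wpM2l.
rewrite /g; lra.
Qed.

End Trajectories.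

(** * Local error of the reduced K-L step *)

Section LocalError.
Context {R : realType} {m n r : nat}.
Implicit Types (U : 'M[R]_(m, r)) (S : 'M[R]_r) (V : 'M[R]_(n, r)).

(** The first factor bounds I - U U^T; in the second one, n^2 + 1 bounds Psi. *)
Definition projection_const : R :=
  (m * m + r * r)%:R * (2 * r%:R ^+ 2 * ((n * n)%:R + 1) + 1).

Lemma projection_const_ge0 : 0 <= projection_const.
Proof. by rewrite !(mulr_ge0, addr_ge0). Qed.

(** With P = I - U U^T and X V in the range of U,
    0 = P X V = P H (V^T Psi V) + P E V, and V^T Psi V is a small perturbation
    of I; so P H, and with it P X, is as small as E, whatever the size and the
    conditioning of H. *)
Lemma projection_defect U V (S : 'M[R]_r) (H : 'M[R]_(m, r)) (Psi : 'M[R]_n)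
    (X : 'M[R]_(m, n)) (theta : R) :
  orthonormal_cols U -> orthonormal_cols V -> U *m S = X *m V ->
  frob (Psi - 1%:M) <= theta -> theta <= 1 -> r%:R ^+ 2 * theta <= 1 / 2 ->
  frob (X - U *m U^T *m X) <= projection_const * frob (X - H *m V^T *m Psi).
Proof.
move=> UU VV US Psi_theta theta1 theta_r.
set E := X - H *m V^T *m Psi; set P := 1%:M - U *m U^T; set p : R := (m * m + r * r)%:R.
set e := frob E; have e0 : 0 <= e by exact: frob_ge0.
have fU := orthonormal_cols_frob UU; have fV := orthonormal_cols_frob VV.
have fP : frob P <= p.
  apply: le_trans (frobB _ _) _; rewrite /p natrD; apply: lerD (frob1_le _) _.
  apply: le_trans (frobM _ _) _; rewrite frob_tr natrM.
  by apply: ler_pM; rewrite ?frob_ge0.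
have p0 : 0 <= p by [].
have PXV : P *m X *m V = 0.
  rewrite -mulmxA -US mulmxA mulmxBl mul1mx -[U *m U^T *m U]mulmxA UU mulmx1.
  by rewrite subrr mul0mx.
have XE : X = H *m V^T *m Psi + E by rewrite /E addrC subrK.
set H' := P *m H.
have fPE : frob (P *m E) <= p * e.
  by apply: le_trans (frobM _ _) _; apply: ler_wpM2r.
have H'E : H' = - (P *m E *m V) - H' *m (V^T *m (Psi - 1%:M) *m V).
  have -> : V^T *m (Psi - 1%:M) *m V = V^T *m Psi *m V - 1%:M.
    by rewrite [V^T *m (_ - _)]mulmxBr mulmx1 mulmxBl VV.
  rewrite [H' *m (_ - _)]mulmxBr mulmx1 opprB addrCA -[LHS]addr0; congr (_ + _).
  rewrite -opprD -[LHS]oppr0; congr (- _).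
  by rewrite -PXV [in LHS]XE [P *m (_ + _)]mulmxDr mulmxDl addrC /H' !mulmxA.
have fH' : frob H' <= 2 * (p * e * r%:R).
  have b1 : frob (P *m E *m V) <= p * e * r%:R.
    by apply: le_trans (frobM _ _) _; apply: ler_pM; rewrite ?frob_ge0.
  have b2 : frob (V^T *m (Psi - 1%:M) *m V) <= 1 / 2.
    apply: le_trans (frob_sandwich _ _ _) _; apply: le_trans theta_r.
    rewrite frob_tr expr2; apply: ler_pM; rewrite ?mulr_ge0 ?frob_ge0//.
    by apply: ler_pM; rewrite ?frob_ge0.
  have b3 : frob (H' *m (V^T *m (Psi - 1%:M) *m V)) <= frob H' * (1 / 2).
    apply: le_trans (frobM _ _) _; apply: ler_wpM2l => //; exact: frob_ge0.
  have : frob H' <= p * e * r%:R + frob H' * (1 / 2).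
    rewrite {1}H'E; apply: le_trans (frobB _ _) _; rewrite frobN.
    exact: lerD.
  lra.
have fPsi : frob Psi <= (n * n)%:R + 1.
  rewrite -[Psi](subrK 1%:M) addrC; apply: le_trans (frobD _ _) _.
  by apply: lerD (frob1_le _) _; lra.
have -> : X - U *m U^T *m X = H' *m V^T *m Psi + P *m E.
  rewrite /H' -!mulmxA [H *m (_ *m _)]mulmxA -mulmxDr -XE.
  by rewrite mulmxBl mul1mx mulmxA.
apply: le_trans (frobD _ _) _.
apply: (@le_trans _ _ (2 * (p * e * r%:R) * r%:R * ((n * n)%:R + 1) + p * e)).
  apply: lerD => //; apply: le_trans (frobM _ _) _.
  apply: ler_pM; rewrite ?frob_ge0//.
  apply: le_trans (frobM _ _) _; rewrite frob_tr.
  by apply: ler_pM; rewrite ?frob_ge0.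
rewrite le_eqVlt; apply/orP; left; apply/eqP.
by rewrite /projection_const -/p; ring.
Qed.

(** The step replaces Y + dA by its orthogonal projection onto range(U'), which
    contains the columns of (Y + dA) V. *)
Lemma reduced_KL_step_projection U S V (dA : 'M[R]_(m, n)) U' S' V' :
  orthonormal_cols V -> reduced_KL_step U S V dA U' S' V' ->
  let X := U *m S *m V^T + dA in
  U' *m S' *m V'^T = U' *m U'^T *m X /\ exists Sh : 'M[R]_r, U' *m Sh = X *m V.
Proof.
move=> VV [_ [Sh ShE] _ LE] X; split.
  rewrite -[LHS]mulmxA -[U' *m U'^T *m X]mulmxA; congr (_ *m _).
  rewrite -[S' *m _]trmxK trmx_mul trmxK LE /L_matrix -mulmxDl trmx_mul.
  by rewrite linearD /= !trmx_mul !trmxK !mulmxA.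
by exists Sh; rewrite ShE /K_matrix mulmxDl -[_ *m V^T *m V]mulmxA VV mulmx1.
Qed.

Lemma local_error (F : R -> 'M[R]_(m, n) -> 'M[R]_(m, n))
    (L kap omega theta h : R) (A : R -> 'M[R]_(m, n)) U S V dA U' S' V' :
  0 <= L -> 0 <= kap -> 0 <= omega -> 0 <= h ->
  (forall t X Z, 0 <= t <= h -> frob (F t X - F t Z) <= L * frob (X - Z)) ->
  (forall t (X : 'M[R]_(m, r)) (Z : 'M[R]_(r, n)), 0 <= t <= h ->
    exists M N E, [/\ F t (X *m Z) = M *m (X *m Z) + X *m Z *m N + E,
      frob M <= kap, frob N <= kap & frob E <= omega]) ->
  expR (kap * h) - 1 <= theta -> theta <= 1 -> r%:R ^+ 2 * theta <= 1 / 2 ->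
  orthonormal_cols V -> straddle_solution F 0 h A -> A 0 = U *m S *m V^T ->
  reduced_KL_step U S V dA U' S' V' ->
  frob (U' *m S' *m V'^T - A h) <= (projection_const + 1) *
    (frob (U *m S *m V^T + dA - A h) + expR (L * h) * (omega * h)).
Proof.
move=> L0 kap0 omega0 h0 FL Fsplit kh theta1 theta_r VV AF A0 step.
have [Y'E [Sh ShE]] := reduced_KL_step_projection VV step.
have [U'U' _ _ _] := step.
set X := _ + dA in Y'E ShE *; set d := frob (X - A h).
have d0 : 0 <= d by exact: frob_ge0.
have c0 := projection_const_ge0; set c := projection_const in c0 *.
apply: (@le_of_slack _ _ _ (c * (expR (L * h) * h))).
  by rewrite !mulr_ge0 ?expR_ge0.
move=> eta eta0.
have [H [Psi [Psi1 AH]]] :=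
  low_rank_tracking L0 kap0 omega0 h0 eta0 FL Fsplit AF A0.
have := projection_defect H U'U' VV ShE (le_trans Psi1 kh) theta1 theta_r.
rewrite -/c -Y'E frob_distC => defect.
have XH : frob (X - H *m V^T *m Psi) <= d + gronwall_bound L (omega + eta) 0 h.
  by apply: le_trans (frob_sub _ (A h) _) _; rewrite lerD2l.
have := frob_sub (U' *m S' *m V'^T) X (A h).
have := ler_wpM2l c0 XH.
have : 0 <= expR (L * h) * (omega * h) by rewrite !mulr_ge0 ?expR_ge0.
rewrite -/d /gronwall_bound add0r.
lra.
Qed.

End LocalError.

(** All hypotheses on F enter through this splitting of its values on matrices
    of rank at most r. *)
Lemma splitting_of_field (R : realType) (m n r : nat) (T B LF eps c : R)
    (F : R -> 'M[R]_(m, n) -> 'M[R]_(m, n)) (t : R)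
    (X : 'M[R]_(m, r)) (Z : 'M[R]_(r, n)) :
  (r < m)%N -> (r < n)%N -> (forall Y : 'M[R]_(m, n), splits_with c Y) ->
  standing_assumptions r T B LF eps F -> 0 <= t <= T ->
  exists M N E, [/\ F t (X *m Z) = M *m (X *m Z) + X *m Z *m N + E,
    frob M <= c * (2 * `|LF|), frob N <= c * (2 * `|LF|) & frob E <= c * eps].
Proof.
move=> rm rn csplit [_ _ FL eps0 FN] tT.
apply: csplit => // x y.
apply: tangency_estimate => //.
  move=> X1 X2; apply: le_trans (FL _ _ _ tT) _.
  by apply: ler_wpM2r; rewrite ?frob_ge0// ler_norm.
by move=> U S V UU VV Su; exact: FN.
Qed.

(** * Global error *)

(** The local errors, at most T / h of them, are each amplified by at most
    expR (L T). *)
Lemma global_error (R : realType) (L h T loc delta : R) (N : nat) (e : nat -> R) :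
  0 <= L -> 0 < h -> 0 <= loc -> 0 <= delta -> N%:R * h <= T ->
  e 0%N <= delta ->
  (forall k, (k < N)%N -> e k.+1 <= expR (L * h) * e k + loc) ->
  forall k, (k <= N)%N -> e k <= expR (L * T) * (delta + T * (loc / h)).
Proof.
move=> L0 h0 loc0 delta0 NT e0 rec k kN.
have bound : e k <= expR (L * (k%:R * h)) * (delta + k%:R * loc).
  elim: k kN => [_|k IHk kN].
    by rewrite mul0r mulr0 expR0 mul1r mul0r addr0.
  apply: (le_trans (rec k kN)).
  have ek := IHk (ltnW kN).
  have -> : L * (k.+1%:R * h) = L * h + L * (k%:R * h) by rewrite -natr1; ring.
  rewrite expRD.
  have -> : expR (L * h) * expR (L * (k%:R * h)) * (delta + k.+1%:R * loc) =
      expR (L * h) * (expR (L * (k%:R * h)) * (delta + k%:R * loc)) +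
      expR (L * h) * expR (L * (k%:R * h)) * loc by rewrite -natr1; ring.
  apply: lerD; first by apply: ler_wpM2l => //; exact: expR_ge0.
  rewrite -[leLHS]mul1r; apply: ler_wpM2r => //.
  rewrite -expRD; apply: le_trans (expR_ge1Dx _); rewrite lerDl.
  by rewrite addr_ge0 ?mulr_ge0// ltW.
apply: le_trans bound _.
have khT : k%:R * h <= T.
  by apply: le_trans NT; apply: ler_wpM2r; [exact: ltW | rewrite ler_nat].
apply: ler_pM.
- exact: expR_ge0.
- by rewrite addr_ge0 ?mulr_ge0.
- by rewrite ler_expR; apply: ler_wpM2l.
- rewrite lerD2l.
  have -> : k%:R * loc = k%:R * h * (loc / h) by field; rewrite gt_eqF.
  by apply: ler_wpM2r => //; rewrite divr_ge0// ltW.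
Qed.

Theorem theorem5p1 (R : realType) (m n r : nat) (T B LF : R)
    (r_gt0 : (1 <= r)%N) (r_lt : (r < minn m n)%N) (T_gt0 : 0 < T) :
  exists (h0 CT : R) (CT' : R -> R),
    [/\ 0 < h0, 0 < CT, (forall Cinc : R, 0 < CT' Cinc) &
      forall (eps : R) (F : R -> 'M[R]_(m, n) -> 'M[R]_(m, n))
        (t0 delta : R) (A0 : 'M[R]_(m, n)) (A : R -> 'M[R]_(m, n))
        (U0 : 'M[R]_(m, r)) (S0 : 'M[R]_r) (V0 : 'M[R]_(n, r)),
      standing_assumptions r T B LF eps F ->
      0 <= t0 <= T ->
      solves_ivp F t0 T A0 A ->
      orthonormal_cols U0 -> orthonormal_cols V0 -> S0 \in unitmx ->
      frob (U0 *m S0 *m V0^T - A t0) <= delta ->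
      forall (h : R) (dA : nat -> 'M[R]_(m, n))
        (U : nat -> 'M[R]_(m, r)) (S : nat -> 'M[R]_r)
        (V : nat -> 'M[R]_(n, r)) (Aloc : nat -> R -> 'M[R]_(m, n)),
      0 < h <= h0 ->
      rank_admissible_sequence T t0 h U0 S0 V0 dA U S V ->
      local_solutions T t0 h F (lowrank_iterate U S V) Aloc ->
      let dh := max_increment_error T t0 h (lowrank_iterate U S V) dA Aloc in
      let err := max_global_error T t0 h (lowrank_iterate U S V) A in
      err <= CT * (delta + eps + dh / h) /\
      forall p Cinc : R, 1 <= p ->
        dh <= Cinc * (h `^ (p + 1) + h * eps) ->
        err <= CT' Cinc * (delta + eps + h `^ p)].
Proof.
have [rm rn] : (r < m)%N /\ (r < n)%N by move: r_lt; rewrite leq_min => /andP[].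
have [c c0 csplit] := @tangent_splitting R m n.
pose L : R := `|LF|; have L0 : 0 <= L by exact: normr_ge0.
pose kap : R := c * (2 * L) + 1.
have kap_gt0 : 0 < kap by rewrite ltr_wpDl// !mulr_ge0.
have rR1 : 1 <= r%:R :> R by rewrite ler1n.
pose theta : R := (2 * r%:R ^+ 2)^-1.
have r2 : 1 <= r%:R ^+ 2 :> R by rewrite exprn_ege1.
have theta_gt0 : 0 < theta by rewrite invr_gt0; lra.
have theta_r : r%:R ^+ 2 * theta = 1 / 2.
  by rewrite /theta; field; rewrite gt_eqF//; lra.
have theta1 : theta <= 1.
  apply: (@le_trans _ _ (r%:R ^+ 2 * theta)); last by rewrite theta_r; lra.
  by rewrite -[leLHS]mul1r; apply: ler_wpM2r => //; exact: ltW.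
(* The step size bound that keeps the right factors within theta of I. *)
pose h0 : R := ln (1 + theta) / kap.
have h0_gt0 : 0 < h0 by rewrite divr_gt0// ln_gt0// ltrDl.
pose K : R := @projection_const R m n r + 1.
have K1 : 1 <= K by rewrite lerDr projection_const_ge0.
have K0 : 0 <= K by lra.
pose C1 : R := K * (1 + expR (L * h0) * c).
have C10 : 0 <= C1 by rewrite mulr_ge0// addr_ge0// mulr_ge0 ?expR_ge0.
pose CT : R := expR (L * T) * (1 + T * C1).
have TC1 : 0 <= T * C1 by rewrite mulr_ge0// ltW.
have CT0 : 0 < CT by rewrite mulr_gt0 ?expR_gt0// ltr_pwDl.
exists h0, CT, (fun Cinc => CT * (1 + `|Cinc|)); split => //.
  by move=> Cinc; rewrite mulr_gt0// ltr_pwDl.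
move=> eps F t0 delta A0 A U0 S0 V0 FT /andP[t00 t0T] AF UU0 VV0 _ Y0A.
move=> h dA U S V Aloc /andP[h_gt0 hh0] [U0E S0E V0E steps] locals dh err.
have h_ge0 : 0 <= h by exact: ltW.
have [_ _ FL eps0 _] := FT.
have delta0 : 0 <= delta by exact: le_trans (frob_ge0 _) Y0A.
have dh0 : 0 <= dh by exact: bigmax_ge_id.
pose Y := lowrank_iterate U S V.
pose e k := frob (Y k - A (grid t0 h k)).
have kh : expR (kap * h) - 1 <= theta.
  rewrite lerBlDl -[leRHS]lnK ?posrE ?ltr_wpDl ?addr_gt0//.
  rewrite ler_expR mulrC -ler_pdivlMr//.
have A_straddle := solves_ivp_straddle AF.
have grid_le k : (k <= nsteps T t0 h)%N -> grid t0 h k <= T.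
  case: k => [_|k]; first by rewrite /grid mul0r addr0.
  by rewrite ltn_nsteps.
have grid_ge k : 0 <= k%:R * h by rewrite mulr_ge0.
have VV k : (k <= nsteps T t0 h)%N -> orthonormal_cols (V k).
  case: k => [_|k]; first by rewrite V0E.
  by rewrite ltn_nsteps// => /steps [_ []].
pose loc := K * (dh + expR (L * h0) * (c * eps * h)).
have loc0 : 0 <= loc.
  by rewrite mulr_ge0// addr_ge0// !mulr_ge0 ?expR_ge0.
have rec k : (k < nsteps T t0 h)%N -> e k.+1 <= expR (L * h) * e k + loc.
  move=> kN; have /steps[_ step] : grid t0 h k.+1 <= T by rewrite -ltn_nsteps.
  have Sgrid : grid t0 h k.+1 = grid t0 h k + h by rewrite /grid -natr1; ring.
  have gridT : grid t0 h k + h <= T by rewrite -Sgrid; exact: grid_le.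
  have gridI s : 0 <= s <= h -> 0 <= grid t0 h k + s <= T.
    move=> /andP[s0 sh]; rewrite !addr_ge0//=.
    by apply: le_trans gridT; rewrite lerD2l.
  pose G s := F (grid t0 h k + s).
  have GL s X Z : 0 <= s <= h -> frob (G s X - G s Z) <= L * frob (X - Z).
    move=> /gridI sT; apply: le_trans (FL _ _ _ sT) _.
    by apply: ler_wpM2r; rewrite ?frob_ge0// ler_norm.
  have Gsplit s (X : 'M[R]_(m, r)) (Z : 'M[R]_(r, n)) : 0 <= s <= h ->
      exists M N E, [/\ G s (X *m Z) = M *m (X *m Z) + X *m Z *m N + E,
        frob M <= kap, frob N <= kap & frob E <= c * eps].
    move=> /gridI sT.
    have [M [N [E [GE Mk Nk Ee]]]] := splitting_of_field X Z rm rn csplit FT sT.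
    by exists M, N, E; split=> //; rewrite ler_wpDr.
  have Aloc_sol : solves_ivp G 0 h (Y k) (Aloc k).
    by apply: locals; rewrite Sgrid.
  have Aloc_straddle := solves_ivp_straddle Aloc_sol.
  have [Aloc0 _] := Aloc_sol.
  have A_shift := straddle_solution_shift _ gridT A_straddle.
  have err_loc := local_error L0 (ltW kap_gt0) (mulr_ge0 c0 eps0) h_ge0 GL Gsplit
    kh theta1 _ (VV k (ltnW kN)) Aloc_straddle Aloc0 step.
  have dk : frob (Y k + dA k - Aloc k h) <= dh.
    exact: (le_bigmax _ (fun k : 'I__ => frob (Y k + dA k - Aloc k h)) (Ordinal kN)).
  have err_stab := stability L0 h_ge0 GL Aloc_straddle (A_shift _).
  rewrite /e Sgrid [expR _ * _ + _]addrC.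
  apply: le_trans (frob_sub _ (Aloc k h) _) _; apply: lerD.
    apply: le_trans (err_loc _) _; first by rewrite theta_r.
    apply: ler_wpM2l => //; apply: lerD => //; apply: ler_pM => //.
    - by rewrite !mulr_ge0.
    - by rewrite ler_expR; apply: ler_wpM2l.
  apply: le_trans (err_stab _) _; first by rewrite lerDl.
  by rewrite Aloc0 addr0.
have NT : (nsteps T t0 h)%:R * h <= T.
  by apply: le_trans (grid_le _ (leqnn _)); rewrite /grid lerDr.
have e0 : e 0%N <= delta.
  by rewrite /e /Y /lowrank_iterate U0E S0E V0E /grid mul0r addr0.
have dhh0 : 0 <= dh / h by exact: divr_ge0.
have main : err <= CT * (delta + eps + dh / h).
  apply: bigmax_le => [|[k kN] _ /=].
    by rewrite mulr_ge0 ?(ltW CT0)// !addr_ge0.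
  have := global_error L0 h_gt0 loc0 delta0 NT e0 rec.
  move=> /(_ k kN) /le_trans; apply.
  rewrite /CT -mulrA; apply: ler_wpM2l; first exact: expR_ge0.
  have -> : loc / h = K * (dh / h + expR (L * h0) * c * eps).
    by rewrite /loc; field; rewrite gt_eqF.
  set a := expR (L * h0) * c; have a0 : 0 <= a by rewrite mulr_ge0 ?expR_ge0.
  have : K * (dh / h + a * eps) <= C1 * (eps + dh / h).
    rewrite /C1 -/a -mulrA; apply: ler_wpM2l => //.
    have := mulr_ge0 a0 dhh0; lra.
  move=> /(ler_wpM2l (ltW T_gt0)).
  have := mulr_ge0 TC1 delta0; lra.
split=> // p Cinc p1 dh_le.
apply: (le_trans main); rewrite -mulrA; apply: ler_wpM2l; first exact: ltW.
have hp0 : 0 <= h `^ p by exact: powR_ge0.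
have : dh / h <= `|Cinc| * (h `^ p + eps).
  rewrite ler_pdivrMr//; apply: (le_trans dh_le).
  have -> : h `^ (p + 1) = h `^ p * h.
    rewrite powRD ?powRr1//; apply/implyP => _; exact: lt0r_neq0.
  have -> : h `^ p * h + h * eps = (h `^ p + eps) * h by ring.
  rewrite mulrA; apply: ler_wpM2r => //; apply: ler_wpM2r; last exact: ler_norm.
  exact: addr_ge0.
have : 0 <= `|Cinc| * delta by exact: mulr_ge0.
lra.
Qed.
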